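(* Let $K/F$ be Galois with $\mathrm{Gal}(K/F)=\langle\sigma\rangle\simeq G=\mathbb{Z}/p^n\mathbb{Z}$. Let $A$ be a finite $\mathbb{F}_p[G]$-module and $\lambda\in\{1,\dots,p^n\}$ such that $A\bullet_\lambda G$ is defined, and suppose $E$ solves $A\bullet_\lambda G\to G\to1$ over $K/F$. Let $M$ be a finite $\mathbb{F}_p[G]$-module having a cyclic direct summand of $\mathbb{F}_p$-dimension $\mu$ with $\lambda<\mu<p^n$. Then the number of fields $L$ with $K\subseteq L\subseteq E$ solving $M\bullet_\mu G\to G\to1$ over $K/F$ is $$\prod_{i=1}^{p^n}\binom{\Delta(A_{\{i\}})-\Delta(M_{\{i+1\}})-\mathbf{1}_{i=\lambda}}{\Delta(M_{\{i\}})-\Delta(M_{\{i+1\}})}_p\times\left[\prod_{i=1}^{p^n}\left(\frac{p^{\sum_{j<i}(\Delta(A_{\{j\}})-\mathbf{1}_{j=\lambda}\mathbf{1}_{i<\mu})}}{p^{\sum_{j<i}\Delta(M_{\{j\}})}}\right)^{\Delta(M_{\{i\}})-\Delta(M_{\{i+1\}})}-\prod_{i=1}^{p^n}\left(\frac{p^{\sum_{j<i}(\Delta(A_{\{j\}})-\mathbf{1}_{j=\lambda}\mathbf{1}_{i\le\mu})}}{p^{\sum_{j<i}\Delta(M_{\{j\}})}}\right)^{\Delta(M_{\{i\}})-\Delta(M_{\{i+1\}})}\right].$$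
   Context: For an $\mathbb{F}_p[G]$-module $V$ (additive), $V_{\{i\}}=(\sigma-1)^{i-1}V\cap V^G$ for $1\le i\le p^n+1$ and $\Delta(\cdot)=\dim_{\mathbb{F}_p}$. $\binom{N}{m}_p=\frac{(p^N-1)\cdots(p^{N-m+1}-1)}{(p^m-1)\cdots(p-1)}$ for $0\le m\le N$, $0$ otherwise. $\mathbf{1}$ is the indicator. Groups: for a finite module $B=\bigoplus\mathbb{F}_p[G]\beta_i$ (a fixed decomposition into cyclic modules) and $\nu<p^n$ with some $\beta_{i_0}$ of dimension $\nu$, $B\bullet_\nu G$ is generated by $B$ and $\hat\sigma$ with the relations of $B$, $\hat\sigma b\hat\sigma^{-1}=\sigma b$, $\hat\sigma^{p^n}=(\sigma-1)^{\nu-1}\beta_{i_0}$; $B\bullet_{p^n}G=B\rtimes G$; the map to $G$ kills $B$ and sends $\hat\sigma\mapsto\sigma$. A field $L\supseteq K$ Galois over $F$ solves $\varphi:\hat G\to G$ over $K/F$ if there is an isomorphism $\psi:\mathrm{Gal}(L/F)\to\hat G$ with $\varphi\circ\psi$ equal to restriction to $\mathrm{Gal}(K/F)=G$. *)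

(* Defs.v *)
From HB Require Import structures.
From mathcomp Require Import all_boot all_order all_algebra all_fingroup.
From mathcomp Require Import all_solvable all_field all_character.

Set Implicit Arguments.
Unset Strict Implicit.
Unset Printing Implicit Defensive.

Import Order.TTheory GRing.Theory Num.Theory.
Local Open Scope ring_scope.

(* An F_p[<s>]-module is a representation rG : mx_representation 'F_p <[s]> d,
   acting on the space 'rV['F_p]_d by g b := b *m rG g; since <[s]> is abelian,
   left and right modules coincide. *)

Section Modules.

Variables (p : nat) (gT : finGroupType) (s : gT) (d : nat).
Variable rG : mx_representation 'F_p <[s]>%g d.

(* V_{i} = (s - 1)^(i-1) V :&: V^G, as a row space; used for i >= 1 only. *)
Definition Vlayer (i : nat) : 'M['F_p]_d :=
  (((rG s - 1%:M) ^+ i.-1)%R :&: rfix_mx rG <[s]>%g)%MS.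

Definition Delta (i : nat) : nat := \rank (Vlayer i).

Record cyclic_decomp := CyclicDecomp {
  cd_size : nat;
  cd_gen :> 'I_cd_size -> 'rV['F_p]_d;
  cd_full : (\sum_(i < cd_size) cyclic_mx rG (cd_gen i) :=: 1%:M)%MS;
  cd_direct : mxdirect (\sum_(i < cd_size) cyclic_mx rG (cd_gen i))
}.

Variant bullet_defined (D : cyclic_decomp) (nu : nat) : Type :=
  | BulletSummand (i0 : 'I_(cd_size D))
      of \rank (cyclic_mx rG (D i0)) = nu & (nu < #[s]%g)%N
  | BulletSemidirect of nu = #[s]%g.

(* The element to which hat sigma ^ #[s] is equated. *)
Definition bullet_vec D nu (h : bullet_defined D nu) : 'rV['F_p]_d :=
  match h with
  | BulletSummand i0 _ _ => D i0 *m ((rG s - 1%:M) ^+ nu.-1)%R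
  | BulletSemidirect _ => 0
  end.

(* The elements of V^<s>. *)
Definition fixvec : Type := {w : 'rV['F_p]_d | w *m rG s == w}.

Lemma bullet_nilp n : prime p -> #[s]%g = (p ^ n)%N ->
  (rG s - 1%:M) ^+ (p ^ n) = 0.
Proof.
move=> pr_p os.
have pw k (X : 'M['F_p]_d) : (X - 1%:M) ^+ (p ^ k) = X ^+ (p ^ k) - 1%:M.
  case: d X => [|d'] X; first by apply/matrixP=> -[].
  have ch : p \in [pchar 'M['F_p]_d'.+1].
    by rewrite pchar_lalg pchar_Fp.
  elim: k => [|k IHk]; first by rewrite !expn0 !expr1.
  rewrite expnSr !exprM IHk -!(pFrobenius_autE ch).
  rewrite pFrobenius_autB_comm ?pFrobenius_aut1 //.
  exact: commr1.
rewrite pw; apply/eqP; rewrite subr_eq0; apply/eqP.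
have rX k : rG (s ^+ k)%g = rG s ^+ k.
  elim: k => [|k IHk]; first by rewrite expg0 repr_mx1.
  by rewrite expgS repr_mxM ?mem_cycle ?cycle_id // IHk exprS.
by rewrite -rX -os expg_order repr_mx1.
Qed.

Lemma cyclic_ann n (u : 'rV['F_p]_d) : prime p -> #[s]%g = (p ^ n)%N ->
  u *m (rG s - 1%:M) ^+ \rank (cyclic_mx rG u) = 0.
Proof.
move=> pr_p os; set T := rG s - 1%:M; set W := cyclic_mx rG u.
have nT : T ^+ (p ^ n) = 0 by apply: bullet_nilp.
have WT : (W *m T <= W)%MS.
  rewrite mulmxBr mulmx1 addmx_sub ?eqmx_opp //.
  by have /mxmoduleP-> := cyclic_mx_module rG u; rewrite ?cycle_id.
have TS i : T ^+ i.+1 = T *m T ^+ i by rewrite exprS.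
have TSr i : T ^+ i.+1 = T ^+ i *m T by rewrite exprSr.
have dec i : (W *m T ^+ i.+1 <= W *m T ^+ i)%MS.
  by rewrite TS mulmxA submxMr.
have rk i : (\rank (W *m T ^+ i) <= \rank W - i)%N.
  elim: i => [|i IHi]; first by rewrite expr0 mulmx1 subn0.
  have [z|nz] := eqVneq (W *m T ^+ i) 0.
    by rewrite TSr mulmxA z mul0mx mxrank0.
  suff lt : (\rank (W *m T ^+ i.+1) < \rank (W *m T ^+ i))%N.
    rewrite subnS -ltnS; case E: (\rank W - i)%N IHi => [|m] IHi.
      by move: lt; rewrite ltnNge (leq_trans IHi).
    exact: leq_trans lt IHi.
  rewrite ltn_neqAle mxrankS // andbT; apply: contraNneq nz => eqr.
  have sub : (W *m T ^+ i <= W *m T ^+ i.+1)%MS.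
    by have := mxrank_leqif_sup (dec i); rewrite eqr => -[_ <-].
  have all_sub k : (W *m T ^+ i <= W *m T ^+ (i + k))%MS.
    elim: k => [|k IHk]; first by rewrite addn0.
    apply: (submx_trans sub); rewrite addnS !TSr !mulmxA.
    exact: submxMr.
  have := all_sub (p ^ n)%N; rewrite exprD nT mulr0 mulmx0.
  by rewrite submx0.
have := rk (\rank W); rewrite subnn leqn0 mxrank_eq0 => /eqP z.
apply/eqP; rewrite -submx0 -z; apply: submxMr.
exact: cyclic_mx_id.
Qed.

Lemma bullet_vec_fix n D nu (h : bullet_defined D nu) :
  prime p -> #[s]%g = (p ^ n)%N -> bullet_vec h *m rG s == bullet_vec h.
Proof.
move=> pr_p os; case: h => [i0 rk _|_] /=; last by rewrite mul0mx.
rewrite -subr_eq0 -[X in _ - X]mulmx1 -mulmxBr -mulmxA -[_ *m (_ - _)]exprSr.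
case: nu rk => [|nu] rk /=; last by rewrite -rk (cyclic_ann _ pr_p os).
by move/eqP: rk; rewrite mxrank_eq0 cyclic_mx_eq0 => /eqP->; rewrite mul0mx.
Qed.

Definition bullet_class n (pr_p : prime p) (os : #[s]%g = (p ^ n)%N)
    D nu (h : bullet_defined D nu) : fixvec :=
  exist _ (bullet_vec h) (bullet_vec_fix h pr_p os).

(* The group generated by V and an element t subject to the relations of V,
   t b t^-1 = s b and t ^ #[s] = w: the pair (b, i) stands for b t^i. Lemmas
   cyc_ext_gen, cyc_ext_embM, cyc_ext_conj, cyc_ext_pow and cyc_ext_univ below
   show that it has this presentation. *)
Record cyc_ext (w : fixvec) : Type :=
  CycExt { ce_pair : 'rV['F_p]_d * 'I_#[s]%g }.

Section CycExt.

Variable w : fixvec.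

HB.instance Definition _ := [isNew for @ce_pair w].
HB.instance Definition _ := [Finite of cyc_ext w by <:].

Definition mod_order (k : nat) : 'I_#[s]%g :=
  Ordinal (ltn_pmod k (order_gt0 s)).

Definition ce_mul (x y : cyc_ext w) : cyc_ext w :=
  let: (b, i) := ce_pair x in
  let: (c, j) := ce_pair y in
  CycExt w (b + c *m rG (s ^+ i)%g + val w *+ ((i + j) %/ #[s]%g),
            mod_order (i + j)).

Definition ce_one : cyc_ext w := CycExt w (0, mod_order 0).

Definition ce_inv (x : cyc_ext w) : cyc_ext w :=
  let: (b, i) := ce_pair x in
  let j := mod_order (#[s]%g - i) in
  CycExt w (- (b *m rG (s ^+ j)%g) - val w *+ ((j + i) %/ #[s]%g), j).

Lemma fixvecX k : val w *m rG (s ^+ k)%g = val w.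
Proof.
elim: k => [|k IHk]; first by rewrite expg0 repr_mx1 mulmx1.
rewrite expgS repr_mxM ?mem_cycle ?cycle_id // mulmxA.
by rewrite (eqP (valP w)).
Qed.

Lemma divn_carry m k :
  (m %/ #[s]%g + (m %% #[s]%g + k) %/ #[s]%g = (m + k) %/ #[s]%g)%N.
Proof. by rewrite [in RHS](divn_eq m #[s]%g) -addnA divnMDl ?order_gt0. Qed.

Lemma ce_mulA : associative ce_mul.
Proof.
move=> [[b i]] [[c j]] [[e k]]; congr (CycExt w (_, _)) => /=; last first.
  by apply: val_inj => /=; rewrite modnDml modnDmr addnA.
have wX m : (val w *+ m) *m rG (s ^+ i)%g = val w *+ m.
  by rewrite -scaler_nat -scalemxAl fixvecX.
rewrite !mulmxDl wX -mulmxA -repr_mxM ?mem_cycle // -expgnDr expg_mod_order.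
rewrite -!addrA; congr (_ + (_ + _)).
rewrite [RHS]addrCA [(j + i)%N]addnC; congr (_ + _).
by rewrite -!mulrnDr divn_carry [(i + _ %% _)%N]addnC divn_carry addnC addnA.
Qed.

Lemma ce_mul1 : left_id ce_one ce_mul.
Proof.
move=> [[b i]]; congr (CycExt w (_, _)) => /=.
  by rewrite mod0n expg0 repr_mx1 mulmx1 add0r add0n divn_small // mulr0n addr0.
by apply: val_inj; rewrite /= mod0n add0n modn_small.
Qed.

Lemma ce_mulV : left_inverse ce_one ce_inv ce_mul.
Proof.
move=> [[b i]]; congr (CycExt w (_, _)) => /=.
  by rewrite addrAC subrK addrC subrr.
by apply: val_inj; rewrite /= modnDml subnK ?modnn ?mod0n // ltnW.
Qed.

HB.instance Definition _ :=
  Finite_isGroup.Build (cyc_ext w) ce_mulA ce_mul1 ce_mulV.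

Definition ce_emb (b : 'rV['F_p]_d) : cyc_ext w := CycExt w (b, mod_order 0).

(* The first component vanishes unless #[s] = 1. *)
Definition ce_hat : cyc_ext w :=
  CycExt w (val w *+ (1 %/ #[s]%g), mod_order 1).

(* The projection to <[s]>: it kills V and sends ce_hat to s. *)
Definition ce_proj (x : cyc_ext w) : gT := (s ^+ (ce_pair x).2)%g.

Lemma ce_hatX k :
  (ce_hat ^+ k)%g = CycExt w (val w *+ (k %/ #[s]%g), mod_order k).
Proof.
elim: k => [|k IHk]; first by rewrite div0n mulr0n.
rewrite expgSr IHk; congr (CycExt w (_, _)) => /=; last first.
  by apply: val_inj; rewrite /= modnDm addn1.
rewrite -scaler_nat -(scaler_nat (1 %/ _)) -scalemxAl fixvecX !scaler_nat.
rewrite -!mulrnDr -addnA [(k %% _ + _)%N]addnC divn_carry.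
by rewrite [(1 + _)%N]addnC divn_carry addn1.
Qed.

Lemma cyc_ext_gen (x : cyc_ext w) :
  x = (ce_emb (ce_pair x).1 * ce_hat ^+ (ce_pair x).2)%g.
Proof.
case: x => -[b i]; rewrite ce_hatX /=; congr (CycExt w (_, _)) => /=.
  rewrite mod0n expg0 repr_mx1 mulmx1 add0n modn_small // divn_small //.
  by rewrite mulr0n !addr0.
by apply: val_inj; rewrite /= mod0n add0n modn_mod modn_small.
Qed.

Lemma cyc_ext_embM : {morph ce_emb : b c / b + c >-> (b * c)%g}.
Proof.
move=> b c; congr (CycExt w (_, _)) => /=.
  by rewrite mod0n expg0 repr_mx1 mulmx1 div0n mulr0n addr0.
by apply: val_inj; rewrite /= mod0n addn0 mod0n.
Qed.

Lemma cyc_ext_emb_inj : injective ce_emb.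
Proof. by move=> b c []. Qed.

Lemma cyc_ext_conj b : (ce_hat * ce_emb b * ce_hat^-1)%g = ce_emb (b *m rG s).
Proof.
apply: (mulIg ce_hat); rewrite mulgKV; congr (CycExt w (_, _)) => /=.
  rewrite mod0n expg0 repr_mx1 mulmx1 addn0 add0n expg_mod_order.
  by rewrite expg1 [X in X + _ = _]addrC.
by apply: val_inj; rewrite /= mod0n addn0 add0n.
Qed.

Lemma cyc_ext_pow : (ce_hat ^+ #[s])%g = ce_emb (val w).
Proof.
rewrite ce_hatX divnn order_gt0; congr (CycExt w (_, _)).
by apply: val_inj; rewrite /= modnn mod0n.
Qed.

Lemma cyc_ext_univ (hT : groupType) (f : 'rV['F_p]_d -> hT) (t : hT) :
    {morph f : b c / b + c >-> (b * c)%g} ->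
    (forall b, t * f b * t^-1 = f (b *m rG s))%g ->
    (t ^+ #[s] = f (val w))%g ->
  exists g : cyc_ext w -> hT,
    [/\ {morph g : x y / x * y >-> x * y}%g,
        forall b, g (ce_emb b) = f b & g ce_hat = t].
Proof.
move=> fD ft tq; exists (fun x => f (ce_pair x).1 * t ^+ (ce_pair x).2)%g.
have f0 : f 0 = 1%g by apply: (mulIg (f 0)); rewrite -fD addr0 mul1g.
have fMn b k : f (b *+ k) = (f b ^+ k)%g.
  by elim: k => [|k IHk]; rewrite ?mulr0n ?expg0 // mulrS fD IHk expgS.
have ftX k b : (t ^+ k * f b = f (b *m rG (s ^+ k)) * t ^+ k)%g.
  elim: k b => [|k IHk] b; first by rewrite !expg0 repr_mx1 mulmx1 mul1g mulg1.
  have tf c : (t * f c = f (c *m rG s) * t)%g by rewrite -ft mulgKV.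
  rewrite [(t ^+ _.+1)%g]expgS -mulgA IHk mulgA tf -mulgA expgSr.
  by rewrite repr_mxM ?mem_cycle ?cycle_id // mulmxA.
have tdiv k : (t ^+ k = f (val w *+ (k %/ #[s]%g)) * t ^+ (k %% #[s]%g))%g.
  by rewrite fMn -tq -expgnA -expgnDr mulnC -divn_eq.
split=> [[[b i]] [[c j]]|b|] /=.
- rewrite !fD -!mulgA -tdiv; congr (_ * _)%g.
  by rewrite mulgA ftX -mulgA -expgnDr.
- by rewrite mod0n expg0 mulg1.
- by rewrite -tdiv expg1.
Qed.

Lemma ce_projM : {morph ce_proj : x y / x * y >-> x * y}%g.
Proof. by move=> [[b i]] [[c j]]; rewrite /ce_proj /= expg_mod_order expgnDr. Qed.

Lemma ce_proj_emb b : ce_proj (ce_emb b) = 1%g.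
Proof. by rewrite /ce_proj /= mod0n. Qed.

Lemma ce_proj_hat : ce_proj ce_hat = s.
Proof. by rewrite /ce_proj /= expg_mod_order expg1. Qed.

End CycExt.

Definition bullet n (pr_p : prime p) (os : #[s]%g = (p ^ n)%N)
    D nu (h : bullet_defined D nu) : finGroupType :=
  cyc_ext (bullet_class pr_p os h).

Definition bullet_proj n (pr_p : prime p) (os : #[s]%g = (p ^ n)%N)
    D nu (h : bullet_defined D nu) : bullet pr_p os h -> gT :=
  @ce_proj (bullet_class pr_p os h).

End Modules.

Arguments bullet_proj {p gT s d rG n} pr_p os {D nu} h x.

(* L solves the embedding problem phi : hG -> Gal(K/F) over K/F. Products in
   'Gal(L / F) are read left to right: (x * y) a = y (x a). For the groups
   bullet this convention is immaterial: <[s]> is abelian, and a finite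
   F_p[<s>]-module is isomorphic to its twist by s |-> s^-1, so each extension
   bullet_proj is isomorphic, over <[s]>, to its opposite. *)
Definition solves (k : fieldType) (Om : splittingFieldType k)
    (F K L : {subfield Om}) (hG : finGroupType) (phi : hG -> gal_of K) : Prop :=
  [/\ (K <= L)%VS, galois F L &
      exists psi : {morphism 'Gal(L / F)%g >-> hG},
        isom 'Gal(L / F)%g [set: hG] psi /\
        (forall x a, x \in 'Gal(L / F)%g -> a \in K -> phi (psi x) a = x a)].

Arguments solves {k Om} F K L {hG} phi.

(* The Gaussian binomial coefficient; N may be negative in the applications. *)
Definition qbinom (p : nat) (N m : int) : rat :=
  if (0 <= m) && (m <= N) then
    (\prod_(k < `|m|%N) (p%:R ^ (N - k%:Z) - 1))
      / (\prod_(k < `|m|%N) (p%:R ^ (m - k%:Z) - 1))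
  else 0.

(* Main.v *)
Require Import Defs.
From mathcomp Require Import all_boot all_order all_algebra all_fingroup.
From mathcomp Require Import all_solvable all_field all_character.
From mathcomp Require Import zify.

Set Implicit Arguments.
Unset Strict Implicit.
Unset Printing Implicit Defensive.

Import Order.TTheory GRing.Theory Num.Theory.
Local Open Scope ring_scope.

(* Put T = s - 1 on A and S = s - 1 on M. A field L between K and E that is
   Galois over F corresponds to a submodule H of A, and it solves the problem
   for M exactly when H is the kernel of a surjective module map X : A -> M with
   w X = v + c S^(p^n - 1) for some c, where w and v are the p^n-th powers of
   the lifts of s and c S^(p^n - 1) is the effect of replacing hat s by c hat s.
   As Aut M acts transitively on the socle elements of a given height, this may
   be replaced by: w X lies in S^(mu-1) M but not in S^mu M. So the number of
   fields is (C_(mu-1) - C_mu) / |Aut M|, with C_m the number of surjective X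
   such that w X lies in S^m M, and |Aut M| is the same count for A = M, w = 0.
   To find C_m, dualise: X^T is an injection of M^* into A^*, determined by the
   images z_l of the generators of M^*, taken in order of decreasing dimension
   i; z_l is any element of ker T^i (killed by w when i <= m) for which
   z_l T^(i-1) is independent of its predecessors. Each step multiplies the
   count by p^kappa (p^iota - p^l), and grouping the steps by i gives Gaussian
   binomials and powers of p. *)

(** * Counting independent rows *)

Section Preimage.

Variables (F : fieldType) (d : nat).

Lemma mulmx_cokermx_sub m (x : 'M[F]_(m, d)) (G acc : 'M[F]_d) :
  (x <= kermx (G *m cokermx acc))%MS = (x *m G <= acc)%MS.
Proof. by rewrite sub_kermx submxE mulmxA. Qed.

Lemma kermx_cokermx m (A : 'M[F]_(m, d)) : (kermx (cokermx A) :=: A)%MS.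
Proof.
by apply/eqmxP; rewrite submxE mulmx_ker sub_kermx mulmx_coker !eqxx.
Qed.

(** Rank-nullity is applied twice: to [U] under [G] followed by reduction modulo [acc], and to
    [U *m G] under that reduction, whose kernel is all of [acc]. *)
Lemma mxrank_preimage (U G acc : 'M[F]_d) : (acc <= U *m G)%MS ->
  \rank (U :&: kermx (G *m cokermx acc))%MS =
  (\rank U - \rank (U *m G) + \rank acc)%N.
Proof.
move=> accUG; have := mxrank_mul_ker U (G *m cokermx acc).
have := mxrank_mul_ker (U *m G) (cokermx acc).
have -> : \rank (U *m G :&: kermx (cokermx acc))%MS = \rank acc.
  apply/eqmx_rank/andP; split.
    by rewrite (submx_trans (capmxSr _ _)) ?kermx_cokermx.
  by rewrite sub_capmx accUG kermx_cokermx submx_refl.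
rewrite (mulmxA U G (cokermx acc)) => E1 E2; have := mxrankM_maxl U G.
lia.
Qed.

Lemma mxrank_adds_row (acc : 'M[F]_d) (x : 'rV[F]_d) :
  \rank (acc + x)%MS = (\rank acc + ~~ (x <= acc)%MS)%N.
Proof.
have [xacc|xNacc] := boolP (x <= acc)%MS.
  rewrite addn0; apply/eqmx_rank/andP.
  by rewrite addsmx_sub submx_refl xacc addsmxSl.
apply/eqP; rewrite eqn_leq addn1; apply/andP; split.
  apply: leq_trans (mxrank_adds_leqif acc x).1 _.
  by rewrite -[X in (_ <= X)%N]addn1 leq_add2l rank_leq_row.
rewrite ltn_neqAle mxrankS ?addsmxSl // andbT.
apply: contraNneq xNacc => eq_rk.
have := mxrank_leqif_sup (addsmxSl acc x); rewrite eq_rk => -[_ /esym].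
by rewrite eqxx addsmx_sub => /andP[].
Qed.

End Preimage.

Section CountIndependent.

Variables (F : finFieldType) (d : nat).
Implicit Types (U G acc : 'M[F]_d).

Lemma card_preimage U G acc : (acc <= U *m G)%MS ->
  #|[set x : 'rV[F]_d | (x <= U)%MS && (x *m G <= acc)%MS]| =
  (#|F| ^ (\rank U - \rank (U *m G)) * #|F| ^ \rank acc)%N.
Proof.
move=> accUG; rewrite -expnD -mxrank_preimage // -card_rowg.
by apply: eq_card => x; rewrite !inE sub_capmx mulmx_cokermx_sub.
Qed.

Lemma card_avoid U G acc : (acc <= U *m G)%MS ->
  #|[set x : 'rV[F]_d | (x <= U)%MS && ~~ (x *m G <= acc)%MS]| =
  (#|F| ^ (\rank U - \rank (U *m G)) *
   (#|F| ^ \rank (U *m G) - #|F| ^ \rank acc))%N.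
Proof.
move=> accUG; rewrite mulnBr -(card_preimage accUG) -expnD subnK ?mxrankM_maxl
  //.
rewrite -card_rowg -(cardsID [set x : 'rV[F]_d | (x *m G <= acc)%MS] (rowg U)).
rewrite addnC -addnBA.
  rewrite (eqP (_ : #|_| - #|_| == 0)%N) ?addn0.
    by apply: eq_card => x; rewrite !inE andbC.
  by rewrite subn_eq0; apply/subset_leq_card/subsetP=> x; rewrite !inE.
by apply/subset_leq_card/subsetP=> x; rewrite !inE.
Qed.

Lemma card_col_mx r (P : pred 'M[F]_(1 + r, d)) :
  #|[set X | P X]| = (\sum_(x : 'rV[F]_d) #|[set Y | P (col_mx x Y)]|)%N.
Proof.
under eq_bigr do rewrite -sum1_card.
rewrite pair_big_dep -sum1_card /=.
rewrite (reindex (fun xY : 'rV[F]_d * 'M[F]_(r, d) => col_mx xY.1 xY.2)) /=.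
  by apply: eq_bigl => -[x Y]; rewrite !inE.
exists (fun X => (usubmx X, dsubmx X)) => [[x Y] _|X _] /=.
  by rewrite col_mxKu col_mxKd.
by rewrite vsubmxK.
Qed.

(* Monotonicity of the images U i *m G i keeps the rows chosen so far inside the
   image available to the next row, so the number of choices is constant. *)
Lemma card_indep_rows r (U G : nat -> 'M[F]_d) acc :
    (forall i j, (i <= j < r)%N -> (U i *m G i <= U j *m G j)%MS) ->
    ((0 < r)%N -> acc <= U 0 *m G 0)%MS ->
  #|[set X : 'M[F]_(r, d) | [forall l, (row l X <= U l)%MS] &&
      (\rank (acc + \matrix_l (row l X *m G l))%MS == \rank acc + r)%N]|
  = (\prod_(l < r) (#|F| ^ (\rank (U l) - \rank (U l *m G l)) *
      (#|F| ^ \rank (U l *m G l) - #|F| ^ (\rank acc + l))))%N.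
Proof.
elim: r U G acc => [|r IHr] U G acc UGmono accUG.
  rewrite big_ord0; apply: (@eq_card1 _ 0) => X; rewrite !inE.
  rewrite [X]flatmx0 eqxx; apply/andP; split; first by apply/forallP=> -[].
  by rewrite flatmx0 addn0 addsmx0_id.
rewrite (@card_col_mx r) big_ord_recl /= addn0 -card_avoid ?accUG //.
have matE (x : 'rV_d) (Y : 'M_(r, d)) :
  \matrix_(l < 1 + r) (row l (col_mx x Y) *m G l) =
  col_mx (x *m G 0) (\matrix_(l < r) (row l Y *m G l.+1)).
  apply/row_matrixP=> i; rewrite rowK.
  case: (split_ordP i) => j ->; rewrite ?rowKu ?rowKd ?rowK //.
  by rewrite [j]ord1 row_id row_id.
have allE (x : 'rV_d) (Y : 'M_(r, d)) :
  [forall l : 'I_(1 + r), (row l (col_mx x Y) <= U l)%MS] =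
  (x <= U 0)%MS && [forall l : 'I_r, (row l Y <= U l.+1)%MS].
  apply/forallP/andP=> [xYU|[xU /forallP YU] l].
    split; first by have := xYU (lshift r 0); rewrite rowKu row_id.
    by apply/forallP=> l; have := xYU (rshift 1 l); rewrite rowKd.
  case: (split_ordP l) => j ->; rewrite ?rowKu ?rowKd //.
  by rewrite [j]ord1 row_id.
set good := [set x | _].
(* A first row whose image already lies in [acc] contributes nothing: the other [r] rows raise the
   rank by at most [r]. *)
rewrite (bigID (mem good)) /= [X in (_ + X)%N]big1 ?addn0; last first.
  move=> x; rewrite inE => xN; apply: eq_card0 => Y; rewrite !inE allE matE.
  apply: contraNF xN => /andP[/andP[-> _] /eqP rk] /=.
  apply/negP=> xacc; move: rk; apply/eqP; rewrite neq_ltn; apply/orP; left.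
  set MY := \matrix_(l < r) (row l Y *m G l.+1).
  rewrite addnS ltnS.
  apply: leq_trans (leq_add (leqnn _) (rank_leq_row MY)).
  apply: leq_trans (mxrank_adds_leqif _ _).1; apply: mxrankS.
  rewrite addsmx_sub addsmxSl (col_mx_sub (x *m G 0) MY) addsmxSr andbT.
  exact: submx_trans xacc (addsmxSl _ _).
(* For a good first row, induct with [acc] enlarged by its image, which shifts each exponent by
   one. *)
rewrite -sum_nat_const; apply: eq_bigr => x; rewrite inE => /andP[xU xNacc].
have rkx : \rank (acc + x *m G 0)%MS = (\rank acc).+1.
  by rewrite mxrank_adds_row xNacc addn1.
rewrite (eq_card (B := [set Y : 'M[F]_(r, d) | [forall l, (row l Y <= U
  l.+1)%MS] &&
   (\rank (acc + x *m G 0 + \matrix_l (row l Y *m G l.+1))%MS ==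
     \rank (acc + x *m G 0) + r)%N])); last first.
  move=> Y; rewrite !inE allE matE xU /= rkx addSnnS -addsmxA.
  congr (_ && (_ == _)); apply/eqmx_rank/eqmxP/adds_eqmx => //.
  by apply/eqmx_sym; apply: addsmxE.
rewrite (IHr (fun l => U l.+1) (fun l => G l.+1)).
- by apply: eq_bigr => l _; rewrite rkx addSnnS.
- by move=> i j ij; apply: UGmono; rewrite !ltnS.
move=> r_gt0; rewrite addsmx_sub; apply/andP; split.
  by apply: submx_trans (accUG isT) _; apply: UGmono; rewrite ltnS.
apply: submx_trans (submxMr _ xU) _; apply: UGmono.
by rewrite ltnS.
Qed.

Lemma card_row_free_rows r (U G : nat -> 'M[F]_d) :
    (forall i j, (i <= j < r)%N -> (U i *m G i <= U j *m G j)%MS) ->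
  #|[set X : 'M[F]_(r, d) | [forall l, (row l X <= U l)%MS] &&
      row_free (\matrix_l (row l X *m G l))]|
  = (\prod_(l < r) (#|F| ^ (\rank (U l) - \rank (U l *m G l)) *
      (#|F| ^ \rank (U l *m G l) - #|F| ^ l)))%N.
Proof.
move=> UGmono.
have := @card_indep_rows r U G 0 UGmono (fun _ => sub0mx _ _).
rewrite mxrank0 => <-.
by apply: eq_card => X; rewrite !inE adds0mx.
Qed.

End CountIndependent.

(** * Jordan bases and their duals *)

Section Family.

Variables (F : fieldType) (d : nat) (I : finType) (e : I -> 'rV[F]_d).

Definition fam_mx : 'M[F]_(#|I|, d) := \matrix_(i < #|I|) e (enum_val i).

Lemma row_fam_mx x : row (enum_rank x) fam_mx = e x.
Proof. by rewrite rowK enum_rankK. Qed.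

Lemma fam_mx_sub m (W : 'M[F]_(m, d)) :
  (forall x, e x <= W)%MS -> (fam_mx <= W)%MS.
Proof. by move=> eW; apply/row_subP=> i; rewrite rowK. Qed.

Lemma mxrank_sum_rows_le (A : {set I}) :
  (\rank (\sum_(x in A) <<e x>>)%MS <= #|A|)%N.
Proof.
rewrite -sum1_card; elim/big_ind2: _ => [|M1 n1 M2 n2 le1 le2|x _].
- by rewrite mxrank0.
- exact: leq_trans (mxrank_adds_leqif _ _).1 (leq_add le1 le2).
by rewrite mxrank_gen rank_leq_row.
Qed.

(** The upper bounds for [A] and for its complement add up to the rank of the whole free family, so
    both are attained. *)
Lemma mxrank_sum_rows (A : {set I}) : row_free fam_mx ->
  \rank (\sum_(x in A) <<e x>>)%MS = #|A|.
Proof.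
move=> frQ; apply/eqP; rewrite eqn_leq mxrank_sum_rows_le /=.
rewrite -(leq_add2r #|~: A|) cardsC -(eqP frQ).
apply: leq_trans (leq_add (leqnn _) (mxrank_sum_rows_le (~: A))).
apply: leq_trans (mxrank_adds_leqif _ _).1; apply/mxrankS/fam_mx_sub=> x.
have [xA|xNA] := boolP (x \in A).
  by apply: submx_trans (addsmxSl _ _); rewrite (sumsmx_sup x) ?genmxE.
by apply: submx_trans (addsmxSr _ _); rewrite (sumsmx_sup x) ?inE ?genmxE.
Qed.

Lemma sum_rows_rank_le m (W : 'M[F]_(m, d)) (A : {set I}) : row_free fam_mx ->
  (forall x, (x \in A)%bool -> (e x <= W)%MS) -> (#|A| <= \rank W)%N.
Proof.
move=> frQ AW; rewrite -mxrank_sum_rows // mxrankS //.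
by apply/sumsmx_subP=> x xA; rewrite genmxE AW.
Qed.

Lemma sum_rows_span m (W : 'M[F]_(m, d)) (A : {set I}) : row_free fam_mx ->
  (forall x, (x \in A)%bool -> (e x <= W)%MS) -> #|A| = \rank W ->
  (W <= \sum_(x in A) <<e x>>)%MS.
Proof.
move=> frQ AW cardA.
have sAW : (\sum_(x in A) <<e x>> <= W)%MS.
  by apply/sumsmx_subP=> x xA; rewrite genmxE AW.
by have := mxrank_leqif_sup sAW; rewrite mxrank_sum_rows // cardA => -[_ <-].
Qed.

End Family.

Lemma trmx_exp (R : comPzRingType) d (S : 'M[R]_d) i : (S ^+ i)^T = S^T ^+ i.
Proof.
elim: i => [|i IHi]; first by rewrite !expr0 trmx1.
by rewrite exprS -[_ * _]/(_ *m _) trmx_mul IHi exprSr.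
Qed.

Lemma sum_leq_ord i n : (\sum_(a < n) (i <= a))%N = (n - i)%N.
Proof.
elim: n => [|n IHn]; first by rewrite big_ord0.
rewrite big_ord_recr /= IHn; case: leqP; lia.
Qed.

Lemma card_tagged_set r (rk : nat -> nat) (P : forall l : 'I_r, 'I_(rk l) ->
  bool) :
  #|[set x : {l : 'I_r & 'I_(rk l)} | P (tag x) (tagged x)]| =
  (\sum_(l < r) \sum_(a < rk l) P l a)%N.
Proof.
rewrite -sum1_card (eq_bigl (fun x : {l : 'I_r & 'I_(rk l)} => predT (tag x) &&
  P (tag x) (tagged x))); last first.
  by move=> x; rewrite inE.
rewrite -(sig_big_dep (predT) P (fun _ _ => 1%N)) /=.
by apply: eq_bigr => l _; rewrite big_mkcond; apply: eq_bigr => a _;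
  case: (P l a).
Qed.

Section Jordan.

Variables (F : fieldType) (r : nat) (rk : nat -> nat).

(* g l generates a Jordan block of S of size rk l; rk is a function on nat only
   to avoid casts, its values at l >= r are irrelevant. *)
Definition jidx : finType := {l : 'I_r & 'I_(rk l)}.

Definition jvec d (S : 'M[F]_d) (g : 'I_r -> 'rV[F]_d) (x : jidx) : 'rV[F]_d :=
  g (tag x) *m S ^+ tagged x.

Definition jordan d (S : 'M[F]_d) (g : 'I_r -> 'rV[F]_d) : Prop :=
  [/\ forall l, g l *m S ^+ rk l = 0, row_free (fam_mx (jvec S g))
    & row_full (fam_mx (jvec S g))].

Definition jmk (l : 'I_r) a (lt_a : (a < rk l)%N) : jidx :=
  Tagged (fun l : 'I_r => 'I_(rk l)) (Ordinal lt_a).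

Variables (d : nat) (S : 'M[F]_d) (g : 'I_r -> 'rV[F]_d).
Hypothesis jg : jordan S g.

Lemma jordan_ann (l : 'I_r) a : (rk l <= a)%N -> g l *m S ^+ a = 0.
Proof.
case: jg => g0 _ _ le_a; rewrite -(subnKC le_a) exprD.
by rewrite mulmxA g0 mul0mx.
Qed.

Lemma card_jidx : #|jidx| = d.
Proof. by case: jg => _ /eqP fr /eqP fu; apply: etrans (esym fr) fu. Qed.

Lemma jvecD (x : jidx) i :
  jvec S g x *m S ^+ i = g (tag x) *m S ^+ (tagged x + i).
Proof. by rewrite /jvec -mulmxA exprD. Qed.

Lemma jvec_jmk (l : 'I_r) a (lt_a : (a < rk l)%N) :
  jvec S g (jmk lt_a) = g l *m S ^+ a.
Proof. by []. Qed.

(** The indices of the basis vectors killed by [S ^+ i], that is, of the last [i] vectors of each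
    Jordan chain. *)
Definition jtop i := [set x : jidx | (rk (tag x) <= tagged x + i)%N].

Lemma card_jtop i : #|jtop i| = (\sum_(l < r) (rk l - (rk l - i)))%N.
Proof.
rewrite (card_tagged_set (fun l (a : 'I_(rk l)) => (rk l <= a + i)%N)).
apply: eq_bigr => l _; rewrite -sum_leq_ord; apply: eq_bigr => a _.
by rewrite leq_subLR addnC.
Qed.

Lemma sum_rk : (\sum_(l < r) rk l)%N = d.
Proof.
rewrite -[RHS]card_jidx -[RHS]cardsT.
rewrite -[RHS](eq_card (A := [set x : jidx | xpredT (tag x)]));
  last by move=> x; rewrite !inE.
rewrite (card_tagged_set (fun l (a : 'I_(rk l)) => true)).
by apply: eq_bigr => l _; rewrite sum_nat_const card_ord muln1.
Qed.

(** Basis vectors lying in the image and in the kernel of [S ^+ i] bound both ranks from below;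
    these bounds add up to [d], so both are sharp. *)
Lemma jordan_ranks i :
  \rank (S ^+ i) = (\sum_(l < r) (rk l - i))%N /\ #|jtop i| = \rank (kermx (S
    ^+ i)).
Proof.
have [_ frQ _] := jg.
have le1 : (\sum_(l < r) (rk l - i) <= \rank (S ^+ i))%N.
  have <- : #|[set x : jidx | (i <= tagged x)%N]| = (\sum_(l < r) (rk l - i))%N.
    rewrite (card_tagged_set (fun l (a : 'I_(rk l)) => (i <= a)%N)).
    by apply: eq_bigr => l _; rewrite sum_leq_ord.
  apply: (sum_rows_rank_le frQ) => x; rewrite inE => le_i.
  by rewrite /jvec -(subnK le_i) exprD mulmxA submxMl.
have le2 : (#|jtop i| <= \rank (kermx (S ^+ i)))%N.
  apply: (sum_rows_rank_le frQ) => x; rewrite inE => le_rk.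
  by rewrite sub_kermx jvecD jordan_ann.
have : (\sum_(l < r) (rk l - i) + #|jtop i| = d)%N.
  rewrite card_jtop -big_split /= -sum_rk; apply: eq_bigr => l _; lia.
move: le2; rewrite mxrank_ker; have := rank_leq_row (S ^+ i); lia.
Qed.

Lemma jordan_ker_span i :
  (kermx (S ^+ i) <= \sum_(x in jtop i) <<jvec S g x>>)%MS.
Proof.
have [_ frQ _] := jg; apply: sum_rows_span => //;
  last exact: (jordan_ranks i).2.
by move=> x; rewrite inE => le_rk; rewrite sub_kermx jvecD jordan_ann.
Qed.

End Jordan.

(** On the dual basis [S^T] runs through each chain backwards, so the dual of the last vector of a
    chain generates a block of the same size. *)
Lemma jordan_tr (F : fieldType) r rk d (S : 'M[F]_d) (g : 'I_r -> 'rV[F]_d) :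
  jordan rk S g -> exists g' : 'I_r -> 'rV[F]_d, jordan rk S^T g'.
Proof.
move=> jg; have [g0 frQ fuQ] := jg.
set Q := fam_mx _ in frQ fuQ.
have /row_freeP[B QB] := frQ; have /row_fullP[B' BQ'] := fuQ.
have BQ : B *m Q = 1%:M.
  by rewrite -[B]mul1mx -BQ' -(mulmxA B' Q B) QB mulmx1.
(* As [B] inverts the basis matrix, [cc l b] is the coordinate functional dual to [g l *m S ^+ b],
   and zero for [b] beyond the end of the chain. *)
pose dl (l : 'I_r) (b : nat) : 'cV[F]_#|jidx r rk| := \col_i
  ((tag (enum_val i) == l) && (nat_of_ord (tagged (enum_val i)) == b))%:R.
pose cc l (b : nat) : 'cV[F]_d := B *m dl l b.
have ccE (x : jidx r rk) l (b : nat) : jvec S g x *m cc l b = ((tag x == l) &&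
  (nat_of_ord (tagged x) == b))%:R%:M.
  rewrite -(row_fam_mx (jvec S g) x) -row_mul -/Q /cc (mulmxA Q B) QB mul1mx.
  by apply/matrixP=> i j; rewrite !ord1 !mxE enum_rankK mulr1n.
have ccP u l (b : nat) : (forall x : jidx r rk, jvec S g x *m u = ((tag x == l)
  && (nat_of_ord (tagged x) == b))%:R%:M) -> u = cc l b.
  move=> uP; rewrite -[u]mul1mx -BQ /cc -mulmxA; congr (_ *m _).
  apply/row_matrixP=> i; rewrite row_mul rowK uP.
  by apply/matrixP=> j k; rewrite !ord1 !mxE mulr1n.
have ccout (l : 'I_r) b : (rk l <= b)%N -> cc l b = 0.
  move=> le_b; symmetry; apply: ccP => x; rewrite mulmx0.
  have [xl|] := eqVneq (tag x) l; last by rewrite raddf0.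
  have lt_x : (tagged x < rk l)%N by rewrite -xl ltn_ord.
  by rewrite ltn_eqF ?raddf0 // (leq_trans lt_x).
have jS (x : jidx r rk) (u : 'cV_d) : jvec S g x *m (S *m u) = g (tag x) *m S
  ^+ (tagged x).+1 *m u.
  by rewrite mulmxA /jvec -(mulmxA (g _)) exprSr.
have Scc (l : 'I_r) b : (b.+1 < rk l)%N -> S *m cc l b.+1 = cc l b.
  move=> lt_b; apply: ccP => x; rewrite jS.
  case: (ltnP (tagged x).+1 (rk (tag x))) => [lt_x|ge_x].
    by rewrite -(jvec_jmk S g lt_x) ccE.
  rewrite (jordan_ann jg) // mul0mx.
  have [xl|] := eqVneq (tag x) l; last by rewrite raddf0.
  case: eqP => [xb|]; last by rewrite raddf0.
  by move: lt_b; rewrite -xb -xl ltnNge ge_x.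
have Scc0 (l : 'I_r) : S *m cc l 0 = 0.
  rewrite -(ccout l _ (leqnn _)); apply: ccP => x; rewrite jS.
  case: (ltnP (tagged x).+1 (rk (tag x))) => [lt_x|ge_x].
    rewrite -(jvec_jmk S g lt_x) ccE andbF.
    have [xl|] := eqVneq (tag x) l; last by rewrite raddf0.
    by rewrite ltn_eqF ?raddf0 // -xl ltn_ord.
  rewrite (jordan_ann jg) // mul0mx.
  have [xl|] := eqVneq (tag x) l; last by rewrite raddf0.
  by rewrite ltn_eqF ?raddf0 // -xl ltn_ord.
have SXcc (l : 'I_r) a b : (a + b < rk l)%N ->
    S ^+ a *m cc l (a + b)%N = cc l b.
  elim: a => [|a IHa] lt_ab; first by rewrite expr0 mul1mx.
  by rewrite exprSr -mulmxA addSn Scc ?IHa // ltnW.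
pose g' (l : 'I_r) := (cc l (rk l).-1)^T.
have g'E (l : 'I_r) a : (a < rk l)%N -> g' l *m S^T ^+ a = (cc l ((rk l).-1 -
  a)%N)^T.
  move=> lt_a; rewrite -trmx_exp -trmx_mul; congr (_^T).
  have E : (rk l).-1 = (a + ((rk l).-1 - a))%N by lia.
  by rewrite {1}E SXcc //; lia.
exists g'.
have full : row_full (fam_mx (@jvec F r rk d S^T g')).
  have sB : (B^T <= fam_mx (@jvec F r rk d S^T g'))%MS.
    apply/row_subP=> i; rewrite -tr_col.
    set x := enum_val i.
    have lt_y : ((rk (tag x)).-1 - tagged x < rk (tag x))%N.
      by have := ltn_ord (tagged x); lia.
    have -> : col i B = cc (tag x) (tagged x).
      rewrite /cc colE; congr (_ *m _); apply/matrixP=> j k.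
      rewrite !ord1 !mxE andbT -[i]enum_valK -/x; congr (_%:R).
      rewrite -(inj_eq enum_val_inj) enum_rankK.
      case: (enum_val j) (x) => [l1 a1] [l2 a2]; rewrite -tag_eqE /tag_eq /=.
      by case: eqP => //= e; subst l2; rewrite tagged_asE.
    have <- : @jvec F r rk d S^T g' (jmk lt_y) = (cc (tag x) (tagged x))^T.
      rewrite jvec_jmk g'E //; congr ((cc _ _)^T).
      by have := ltn_ord (tagged x); lia.
    by rewrite -(row_fam_mx (@jvec F r rk d S^T g')) row_sub.
  rewrite /row_full eqn_leq rank_leq_col; apply: leq_trans (mxrankS sB).
  rewrite mxrank_tr; have : row_free B by apply/row_freeP; exists Q.
  by move/eqP->.
split=> //; last by apply/eqP/(etrans (eqP full)); rewrite (card_jidx jg).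
move=> l; rewrite -trmx_exp -trmx_mul.
case: (posnP (rk l)) => [rk0|rk_gt0];
  first by rewrite ccout ?rk0 // mulmx0 trmx0.
have -> : S ^+ rk l *m cc l (rk l).-1 = S *m (S ^+ (rk l).-1 *m cc l ((rk l).-1
  + 0)%N).
  by rewrite addn0 mulmxA -{1}(prednK rk_gt0) exprS.
by rewrite SXcc ?Scc0 ?trmx0 // addn0 prednK.
Qed.

(** * Counting homomorphisms of nilpotent modules *)

Lemma mx_exprS (R : pzRingType) d (T : 'M[R]_d) i : T ^+ i.+1 = T *m T ^+ i.
Proof. exact: exprS. Qed.

Lemma mx_exprSr (R : pzRingType) d (T : 'M[R]_d) i : T ^+ i.+1 = T ^+ i *m T.
Proof. exact: exprSr. Qed.

Lemma mx_exprD (R : pzRingType) d (T : 'M[R]_d) i j :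
  T ^+ (i + j) = T ^+ i *m T ^+ j.
Proof. exact: exprD. Qed.

Section Homs.

Variables (F : fieldType) (r : nat) (rk : nat -> nat) (e d : nat).
Variables (S : 'M[F]_e) (g : 'I_r -> 'rV[F]_e) (T : 'M[F]_d).
Hypothesis jg : jordan rk S g.
Hypothesis rk_gt0 : forall l : 'I_r, (0 < rk l)%N.

Definition gen_mx : 'M[F]_(r, e) := \matrix_l g l.

Definition soc_mx : 'M[F]_(r, e) := \matrix_l (g l *m S ^+ (rk l).-1).

Lemma hom_exp (Y : 'M[F]_(e, d)) i :
  S *m Y = Y *m T -> S ^+ i *m Y = Y *m T ^+ i.
Proof.
move=> SY; elim: i => [|i IHi]; first by rewrite !expr0 mul1mx mulmx1.
by rewrite mx_exprSr -mulmxA SY mulmxA IHi -mulmxA mx_exprSr.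
Qed.

Lemma row_gen_mul (Y : 'M[F]_(e, d)) l : row l (gen_mx *m Y) = g l *m Y.
Proof. by rewrite row_mul rowK. Qed.

Lemma jvec_hom (Y : 'M[F]_(e, d)) (x : jidx r rk) : S *m Y = Y *m T ->
  jvec S g x *m Y = row (tag x) (gen_mx *m Y) *m T ^+ tagged x.
Proof. by move=> SY; rewrite row_gen_mul /jvec -!mulmxA hom_exp. Qed.

Lemma jvec_ext (Y Y' : 'M[F]_(e, d)) :
  (forall x : jidx r rk, jvec S g x *m Y = jvec S g x *m Y') -> Y = Y'.
Proof.
move=> eqY; have [_ _ /row_fullP[B BQ]] := jg.
rewrite -[Y]mul1mx -[Y']mul1mx -BQ -!mulmxA; congr (_ *m _).
by apply/row_matrixP=> i; rewrite !row_mul rowK eqY.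
Qed.

Lemma hom_gen_inj (Y Y' : 'M[F]_(e, d)) :
  S *m Y = Y *m T -> S *m Y' = Y' *m T -> gen_mx *m Y = gen_mx *m Y' -> Y = Y'.
Proof. by move=> SY SY' eqY; apply: jvec_ext => x;
  rewrite !jvec_hom // eqY. Qed.

(** Define [Y] on the Jordan basis by the rows of [Z] and their images under powers of [T];
    commutation can fail only at the end of a chain, where the hypothesis on [Z] secures it. *)
Lemma hom_gen_ex (Z : 'M[F]_(r, d)) : (forall l, row l Z *m T ^+ rk l = 0) ->
  exists2 Y, S *m Y = Y *m T & gen_mx *m Y = Z.
Proof.
move=> Z0; have [_ /row_freeP[B QB] _] := jg.
pose V := fam_mx (fun x : jidx r rk => row (tag x) Z *m T ^+ tagged x).
have YE (x : jidx r rk) : jvec S g x *m (B *m V) = row (tag x) Z *m T ^+ tagged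
  x.
  rewrite -(row_fam_mx (jvec S g) x) -row_mul mulmxA QB mul1mx.
  by rewrite (row_fam_mx (fun x : jidx r rk => _)).
exists (B *m V).
  apply: jvec_ext => x; rewrite (mulmxA _ (B *m V) T) YE.
  rewrite -(mulmxA _ (T ^+ _)) -mx_exprSr.
  have -> : jvec S g x *m (S *m (B *m V)) =
            g (tag x) *m S ^+ (tagged x).+1 *m (B *m V).
    by rewrite mulmxA /jvec -(mulmxA (g _)) mx_exprSr.
  case: (ltnP (tagged x).+1 (rk (tag x))) => [lt_x|ge_x].
    by rewrite -(jvec_jmk S g lt_x) YE.
  rewrite (jordan_ann jg ge_x) mul0mx.
  have -> : (tagged x).+1 = rk (tag x) by apply/eqP;
    rewrite eqn_leq ge_x ltn_ord.
  by rewrite Z0.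
apply/row_matrixP=> l; rewrite row_gen_mul.
by have := YE (jmk (rk_gt0 l)); rewrite jvec_jmk !expr0 !mulmx1.
Qed.

Lemma soc_mx_ker : (kermx S <= soc_mx)%MS.
Proof.
have := jordan_ker_span jg 1; rewrite expr1 => /submx_trans; apply.
apply/sumsmx_subP=> x; rewrite inE addn1 => le_rk; rewrite genmxE.
have -> : jvec S g x = row (tag x) soc_mx.
  by rewrite rowK; congr (_ *m _ ^+ _); have := ltn_ord (tagged x); lia.
exact: row_sub.
Qed.

Lemma soc_mx_free : row_free soc_mx.
Proof.
rewrite /row_free eqn_leq rank_leq_row; apply: leq_trans (mxrankS soc_mx_ker).
have := (jordan_ranks jg 1).2; rewrite expr1 => <-.
rewrite card_jtop -[leqLHS]card_ord -sum1_card; apply: leq_sum => l _.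
have := rk_gt0 l; lia.
Qed.

(** The kernel of [Y] is stable under the nilpotent [S], so if nonzero it meets the socle [kermx S],
    which is spanned by the ends of the chains. *)
Lemma hom_row_free (Y : 'M[F]_(e, d)) : S *m Y = Y *m T ->
  row_free Y = row_free (\matrix_l (row l (gen_mx *m Y) *m T ^+ (rk l).-1)).
Proof.
move=> SY.
have -> : \matrix_l (row l (gen_mx *m Y) *m T ^+ (rk l).-1) = soc_mx *m Y.
  apply/row_matrixP=> l; rewrite rowK row_gen_mul row_mul rowK.
  by rewrite -!mulmxA hom_exp.
apply/idP/idP=> [frY|frSY].
  by rewrite /row_free mxrankMfree //; apply: soc_mx_free.
rewrite -kermx_eq0; apply/rowV0P=> c; rewrite sub_kermx => /eqP cY.
(* [S ^+ e] vanishes because no block is larger than the whole space. *)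
have [N cS] : exists N, c *m S ^+ N = 0.
  exists e.
  apply/eqP; rewrite -submx0; apply: submx_trans (submxMl _ _) _.
  rewrite submx0 -mxrank_eq0 (jordan_ranks jg e).1 sum_nat_eq0.
  apply/forallP=> l; rewrite implyTb subn_eq0 -(sum_rk jg).
  by rewrite (bigD1 l) //= leq_addr.
elim: N c cY cS => [|i IHi] c cY; first by rewrite expr0 mulmx1.
rewrite mx_exprS mulmxA => cSS.
have {cSS} cS : c *m S = 0.
  by apply: IHi cSS; rewrite -mulmxA SY mulmxA cY mul0mx.
have /submxP[D cD] : (c <= soc_mx)%MS.
  by apply: submx_trans soc_mx_ker; rewrite sub_kermx cS.
move: cY; rewrite cD -mulmxA; move/eqP; rewrite -sub_kermx.
by move: frSY; rewrite -kermx_eq0 => /eqP->; rewrite submx0 => /eqP->;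
  rewrite mul0mx.
Qed.

(** Since [f] kills the image of [T], among the basis vectors of [kermx (S ^+ m)] only chain
    generators impose a condition, and these come from blocks of size at most [m]. *)
Lemma hom_vanish (Y : 'M[F]_(e, d)) (f : 'cV[F]_d) m :
    S *m Y = Y *m T -> T *m f = 0 ->
  (kermx (S ^+ m) *m Y *m f == 0) =
  [forall l : 'I_r, (rk l <= m)%N ==> (row l (gen_mx *m Y) *m f == 0)].
Proof.
move=> SY Tf; apply/eqP/forallP=> [ker0 l|gen0].
  apply/implyP=> le_m; rewrite row_gen_mul.
  have /submxP[D ->] : (g l <= kermx (S ^+ m))%MS.
    by rewrite sub_kermx (jordan_ann jg).
  by rewrite -(mulmxA D) -(mulmxA D) ker0 mulmx0.
apply/eqP; rewrite -mulmxA -sub_kermx;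
  apply: submx_trans (jordan_ker_span jg m) _.
apply/sumsmx_subP=> x; rewrite inE => le_rk;
  rewrite genmxE sub_kermx mulmxA jvec_hom //.
case: (posnP (tagged x)) => [x0|x_gt0].
  by move: le_rk; rewrite x0 add0n expr0 mulmx1; apply/implyP/gen0.
by rewrite -(prednK x_gt0) mx_exprSr -!mulmxA Tf !mulmx0.
Qed.

End Homs.

Section KernelRanks.

Variables (F : fieldType) (d : nat) (T : 'M[F]_d) (f : 'cV[F]_d).

(** The room for the image of a generator of a block of size [i]; the flag [b] will be [i <= m],
    when [f] must vanish on that image. *)
Definition kerU (b : bool) i : 'M[F]_d :=
  (kermx (T ^+ i) :&: (if b then kermx f else 1%:M))%MS.

Lemma mxrank_kerU b i :
  \rank (kerU b i) =
  (d - \rank (T ^+ i) - (b && (kermx (T ^+ i) *m f != 0)%R))%N.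
Proof.
rewrite /kerU; case: b => /=; last by rewrite capmx1 subn0 mxrank_ker.
have := mxrank_mul_ker (kermx (T ^+ i)) f; rewrite mxrank_ker => <-.
have -> : \rank (kermx (T ^+ i) *m f) = (kermx (T ^+ i) *m f != 0) :> nat.
  have := rank_leq_col (kermx (T ^+ i) *m f); rewrite -mxrank_eq0.
  by case: (\rank _) => [|[]].
by rewrite addKn.
Qed.

Lemma mxrank_kerU_mul b i :
  (\rank (kerU b i.+1 *m T ^+ i) + \rank (kerU b i) = \rank (kerU b i.+1))%N.
Proof.
rewrite -(mxrank_mul_ker (kerU b i.+1) (T ^+ i)); congr (_ + _)%N.
rewrite /kerU; apply/eqmx_rank/andP; set c := (if b then _ else _).
split; rewrite !sub_capmx.
  rewrite capmxSl capmxSr !andbT; apply: submx_trans (capmxSl _ _) _.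
  by rewrite sub_kermx mx_exprSr mulmxA mulmx_ker mul0mx.
by rewrite capmxSr (submx_trans (capmxSl _ _) (capmxSr _ _)).
Qed.

(** This supplies the nesting needed by [card_row_free_rows]. For [i > j] the extra factor
    [T ^+ (i - j)] lands in [kermx f] because [T *m f = 0]; for [i = j] the flags agree. *)
Lemma kerU_mul_mono (b1 b2 : bool) i j :
  T *m f = 0 -> (j <= i)%N -> (b1 -> b2) -> (i == j -> b1 = b2) ->
  (kerU b1 i.+1 *m T ^+ i <= kerU b2 j.+1 *m T ^+ j)%MS.
Proof.
move=> Tf le_ji b12 eqb; rewrite -{2}(subnK le_ji) mx_exprD mulmxA.
apply: submxMr; rewrite sub_capmx; apply/andP; split.
  rewrite sub_kermx -mulmxA -mx_exprD addnS subnK //.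
  by apply/eqP/sub_kermxP; rewrite capmxSl.
case: b2 b12 eqb => _ eqb; last exact: submx1.
case: (eqVneq i j) eqb => [->|ne_ij] eqb.
  by rewrite subnn expr0 mulmx1 eqb // capmxSr.
have /prednK <- : (0 < i - j)%N by lia.
by rewrite sub_kermx mx_exprSr -!mulmxA Tf !mulmx0.
Qed.

End KernelRanks.

(** A map corresponds to its generator images, one row for each block: [kerU] expresses the
    relations and the vanishing condition, and independence after [T ^+ (rk l).-1] expresses
    injectivity. *)
Lemma card_injective_homs (F : finFieldType) r rk e d (S : 'M[F]_e)
    (g : 'I_r -> 'rV[F]_e) (T : 'M[F]_d) (f : 'cV[F]_d) m :
    jordan rk S g -> (forall l, (l < r)%N -> (0 < rk l)%N) ->
    (forall i j, (i <= j < r)%N -> (rk j <= rk i)%N) -> T *m f = 0 ->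
  let U i := kerU T f (i <= m)%N i in
  #|[set Y : 'M[F]_(e, d) | [&& S *m Y == Y *m T, row_free Y &
      kermx (S ^+ m) *m Y *m f == 0]]| =
  (\prod_(l < r)
    (#|F| ^ \rank (kerU T f (rk l <= m)%N (rk l).-1) *
     (#|F| ^ (\rank (U (rk l)) - \rank (kerU T f (rk l <= m)%N (rk l).-1)) -
       #|F| ^ l)))%N.
Proof.
move=> jg rk_gt0 rk_mono Tf U.
have rk_gt0' (l : 'I_r) : (0 < rk l)%N by apply: rk_gt0.
pose U' l := U (rk l); pose G' l := T ^+ (rk l).-1.
have rkE (l : 'I_r) : (\rank (U' l *m G' l) + \rank (kerU T f (rk l <= m)%N (rk
  l).-1) = \rank (U' l))%N.
  have := mxrank_kerU_mul T f (rk l <= m)%N (rk l).-1.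
  by rewrite (prednK (rk_gt0' l)).
transitivity #|[set X : 'M[F]_(r, d) | [forall l, (row l X <= U' l)%MS] &&
      row_free (\matrix_l (row l X *m G' l))]|; last first.
  rewrite card_row_free_rows.
    by apply: eq_bigr => l _; rewrite -rkE addKn addnK.
  move=> i j /andP[le_ij lt_j]; have := rk_mono i j;
    rewrite le_ij lt_j => /(_ isT) le_rk.
  have pi : (0 < rk i)%N by apply: rk_gt0; apply: leq_ltn_trans lt_j.
  have pj := rk_gt0 j lt_j.
  rewrite /U' /U /G' -(prednK pi) -(prednK pj) /=.
  apply: kerU_mul_mono => //; last by move/eqP->.
    lia.
  by apply: leq_trans; lia.
rewrite -(card_in_imset (f := fun Y => gen_mx g *m Y)); last first.
  move=> Y Y'; rewrite !inE => /and3P[/eqP SY _ _] /and3P[/eqP SY' _ _].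
  exact: (hom_gen_inj jg SY SY').
apply: eq_card => Z; rewrite inE; apply/imsetP/andP=> [[Y]|[/forallP ZU frZ]].
  rewrite inE => /and3P[/eqP SY frY];
    rewrite (hom_vanish jg _ SY Tf) => /forallP van ->.
  split; last by rewrite -(hom_row_free jg rk_gt0' SY).
  apply/forallP=> l; rewrite sub_capmx; apply/andP; split.
    have [g0 _ _] := jg.
    by rewrite sub_kermx row_gen_mul -mulmxA -(hom_exp _ SY) mulmxA g0 mul0mx.
  case: ifP => [le_m|_]; last exact: submx1.
  by rewrite sub_kermx; have := van l; rewrite le_m.
have [l|Y SY YZ] := @hom_gen_ex _ _ _ _ _ _ _ T jg rk_gt0' Z.
  by apply/sub_kermxP; apply: submx_trans (ZU l) (capmxSl _ _).
exists Y => //; rewrite inE SY eqxx (hom_row_free jg rk_gt0' SY) YZ frZ /=.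
rewrite (hom_vanish jg _ SY Tf) YZ; apply/forallP=> l; apply/implyP=> le_m.
have := submx_trans (ZU l) (capmxSr _ _); rewrite le_m.
by rewrite sub_kermx.
Qed.

(** * Jordan bases from cyclic decompositions *)

Section CyclicDecomp.

Variables (p : nat) (gT : finGroupType) (s : gT) (d n : nat).
Variable rG : mx_representation 'F_p <[s]>%g d.
Hypotheses (p_pr : prime p) (os : #[s]%g = (p ^ n)%N).

Let S := rG s - 1%:M.

(** The span on the right contains [u] and is stable under [S], because [cyclic_ann] kills the first
    power left out. *)
Lemma cyclic_mx_sub_powers u :
  (cyclic_mx rG u <= \sum_(a < \rank (cyclic_mx rG u)) <<u *m S ^+ a>>)%MS.
Proof.
set N := \rank _; set W := (\sum_(a < N) _)%MS.
have WS : (W *m S <= W)%MS.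
  rewrite sumsmxMr_gen; apply/sumsmx_subP=> a _.
  rewrite genmxE (eqmxMr _ (genmxE _)) -mulmxA -mx_exprSr.
  have [lt_a|ge_a] := ltnP a.+1 N.
    by rewrite (sumsmx_sup (Ordinal lt_a)) ?genmxE.
  have -> : a.+1 = N by apply/eqP; rewrite eqn_leq ge_a ltn_ord.
  by rewrite (cyclic_ann _ _ p_pr os) sub0mx.
apply: cyclic_mx_sub.
  apply/mxmoduleP=> x /cycleP[i ->].
  elim: i => [|i IHi]; first by rewrite expg0 repr_mx1 mulmx1.
  rewrite expgS repr_mxM ?mem_cycle ?cycle_id // mulmxA.
  apply: submx_trans IHi; apply: submxMr.
  rewrite -[rG s](subrK 1%:M) mulmxDr mulmx1 addmx_sub //; exact: WS.
case E: N => [|N'].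
  by move/eqP: E; rewrite mxrank_eq0 cyclic_mx_eq0 => /eqP->; rewrite sub0mx.
have lt0 : (0 < N)%N by rewrite E.
by rewrite (sumsmx_sup (Ordinal lt0)) // genmxE expr0 mulmx1.
Qed.

(** Discard the zero summands and sort the others by decreasing dimension. The chains of their
    generators span, and there are exactly [d] vectors, so they form a basis. *)
Lemma jordan_of_decomp (D : cyclic_decomp rG) :
  exists r, exists rk : nat -> nat, exists g : 'I_r -> 'rV['F_p]_d,
    [/\ jordan rk S g, forall l, (l < r)%N -> (0 < rk l)%N
      & forall i j, (i <= j < r)%N -> (rk j <= rk i)%N].
Proof.
pose N (i : 'I_(cd_size D)) := \rank (cyclic_mx rG (D i)).
pose le i j := (N j <= N i)%N.
pose sq := sort le [seq i <- enum 'I_(cd_size D) | (0 < N i)%N].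
pose rk l := nth 0%N (map N sq) l.
pose g (l : 'I_(size sq)) := D (tnth (in_tuple sq) l).
have rkE (l : 'I_(size sq)) : rk l = N (tnth (in_tuple sq) l).
  have tE := tnth_nth (tnth (in_tuple sq) l) (in_tuple sq) l.
  by rewrite [in RHS]tE /= -(nth_map _ 0%N N (ltn_ord l)).
have mem_sq i : (i \in sq) = (0 < N i)%N.
  by rewrite mem_sort mem_filter mem_enum andbT.
exists (size sq), rk, g.
have sumN : (\sum_(l < size sq) rk l)%N = d.
  have dimE : (\sum_(i < cd_size D) N i)%N = d.
    have := cd_direct D; rewrite mxdirectE => /eqP /= <-.
    by rewrite (cd_full D) mxrank1.
  apply: etrans dimE.
  under eq_bigr do rewrite rkE.
  rewrite -(big_tuple _ _ (in_tuple sq) xpredT N) /=.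
  rewrite (perm_big _ (permEl (perm_sort le _))) big_filter big_enum_cond /=.
  rewrite big_mkcond /=; apply: eq_bigr => i _; rewrite -/(N i).
  by case: posnP.
have full : row_full (fam_mx (@jvec _ _ rk _ S g)).
  rewrite -sub1mx -(eqmxP (introT eqmxP (cd_full D))).
  apply/sumsmx_subP=> i _.
  case: (posnP (N i)) => [/eqP|N_gt0].
    by rewrite mxrank_eq0 => /eqP->; rewrite sub0mx.
  apply: submx_trans (cyclic_mx_sub_powers _) _.
  apply/sumsmx_subP=> a _; rewrite genmxE.
  have i_sq : i \in sq by rewrite mem_sq.
  have lt_i : (index i sq < size sq)%N by rewrite index_mem.
  pose l := Ordinal lt_i.
  have lE : tnth (in_tuple sq) l = i by rewrite (tnth_nth i) /= nth_index.
  have lt_a : (a < rk l)%N by rewrite rkE lE ltn_ord.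
  have <- : jvec S g (jmk lt_a) = D i *m S ^+ a.
    by rewrite jvec_jmk /g lE.
  by rewrite -(row_fam_mx (@jvec _ _ rk _ S g)) row_sub.
split.
- split=> //; last first.
    rewrite /row_free (eqP full) -{1}sumN.
    have := card_tagged_set (fun (l : 'I_(size sq)) (a : 'I_(rk l)) => true).
    rewrite (eq_card (B := setT)); last by move=> x; rewrite !inE.
    rewrite cardsT => ->; apply/eqP/eq_bigr => l _.
    by rewrite sum_nat_const card_ord muln1.
  by move=> l; rewrite rkE; apply: (cyclic_ann _ _ p_pr os).
- by move=> l lt_l; have := rkE (Ordinal lt_l); rewrite /= => ->;
  rewrite -mem_sq mem_tnth.
move=> i j /andP[le_ij lt_j].
have lt_i : (i < size sq)%N by apply: leq_ltn_trans lt_j.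
have srt : sorted geq (map N sq).
  rewrite sorted_map; apply: (sub_sorted (e := le)) => //.
  by apply: sort_sorted => a b; apply: leq_total.
have := @sorted_leq_nth _ geq (fun y x z h1 h2 => leq_trans h2 h1) leqnn 0%N _
  srt i j.
by rewrite !inE size_map; apply.
Qed.

End CyclicDecomp.

(** * Counting surjections by duality *)

Lemma submx_kermx_tr (F : fieldType) m1 m2 d (A : 'M[F]_(m1, d)) (w :
  'M[F]_(m2, d)) :
  (w <= A)%MS = (kermx A^T *m w^T == 0).
Proof.
apply/idP/eqP=> [/submxP[c ->]|ker0].
  by rewrite trmx_mul mulmxA mulmx_ker mul0mx.
rewrite submxE -(inj_eq trmx_inj) trmx0 trmx_mul.
have /submxP[c ->] : ((cokermx A)^T <= kermx A^T)%MS.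
  by rewrite sub_kermx -trmx_mul mulmx_coker trmx0.
by rewrite -mulmxA ker0 mulmx0.
Qed.

(* The dimension of the kernel of (T^T)^i, cut by the hyperplane w = 0 if b. *)
Definition ker_dim (F : fieldType) d (T : 'M[F]_d) (w : 'rV[F]_d)
    (b : bool) i :=
  (d - \rank (T ^+ i) - (b && ~~ (w <= T ^+ i)%MS))%N.

Lemma mxrank_kerU_tr (F : fieldType) d (T : 'M[F]_d) (w : 'rV[F]_d) b i :
  \rank (kerU T^T w^T b i) = ker_dim T w b i.
Proof.
by rewrite mxrank_kerU -trmx_exp mxrank_tr /ker_dim submx_kermx_tr.
Qed.

(** Transposition gives injections of the dual modules, and by double annihilators the bound on
    [w *m X] becomes the vanishing of [w^T] on the image of [kermx (S^T ^+ m)]. *)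
Lemma card_surjective_homs (F : finFieldType) r rk e d (S : 'M[F]_e)
    (g : 'I_r -> 'rV[F]_e) (T : 'M[F]_d) (w : 'rV[F]_d) m :
    jordan rk S g -> (forall l, (l < r)%N -> (0 < rk l)%N) ->
    (forall i j, (i <= j < r)%N -> (rk j <= rk i)%N) -> w *m T = 0 ->
  #|[set X : 'M[F]_(d, e) | [&& T *m X == X *m S, row_full X &
      (w *m X <= S ^+ m)%MS]]| =
  (\prod_(l < r)
    (#|F| ^ ker_dim T w (rk l <= m) (rk l).-1 *
     (#|F| ^ (ker_dim T w (rk l <= m) (rk l) -
              ker_dim T w (rk l <= m) (rk l).-1) - #|F| ^ l)))%N.
Proof.
move=> jg rk_gt0 rk_mono wT; have [g' jg'] := jordan_tr jg.
have Tw : T^T *m w^T = 0 by rewrite -trmx_mul wT trmx0.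
have := card_injective_homs m jg' rk_gt0 rk_mono Tw; rewrite /=.
under [X in _ = X -> _]eq_bigr do rewrite !mxrank_kerU_tr.
move=> <-; rewrite -(card_imset _ (@trmx_inj _ _ _)).
apply: eq_card => Y; rewrite inE; apply/imsetP/and3P=> [[X]|[SY frY van]].
  rewrite inE => /and3P[/eqP TX fuX wX] ->; split.
  - by rewrite -!trmx_mul TX.
  - by rewrite /row_free mxrank_tr.
  by rewrite -mulmxA -trmx_mul -trmx_exp -submx_kermx_tr.
exists Y^T; last by rewrite trmxK.
rewrite inE; apply/and3P; split.
- by rewrite -(inj_eq trmx_inj) !trmx_mul trmxK eq_sym.
- by rewrite /row_full mxrank_tr.
by rewrite submx_kermx_tr trmx_mul trmxK mulmxA trmx_exp.
Qed.

(** * Gaussian binomials *)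

(** Think of [D i] as the number of blocks of size at least [i]: as sizes decrease, those of size
    exactly [i] occupy the interval from [D i.+1] to [D i]. *)
Lemma prod_group_by_height (R : Type) (idx : R) (op : Monoid.com_law idx)
    (N r : nat) (rk D : nat -> nat) (phi : nat -> nat -> R) :
    (forall i l, (0 < i)%N -> (l < r)%N -> (i <= rk l)%N = (l < D i)%N) ->
    (forall i, (D i.+1 <= D i)%N) -> D 1%N = r -> D N.+1 = 0%N ->
  \big[op/idx]_(l < r) phi (rk l) l =
  \big[op/idx]_(1 <= i < N.+1) \big[op/idx]_(D i.+1 <= l < D i) phi i l.
Proof.
move=> Dlt Ddec D1 DN.
have Dr i : (D i.+1 <= r)%N.
  by elim: i => [|i IHi]; rewrite ?D1 // (leq_trans (Ddec _)).
(* Induction on [k] takes up the blocks from the largest size down: those of size above [N - k] are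
   the first [D (N - k).+1]. *)
suff H k : (k <= N)%N ->
    \big[op/idx]_(0 <= l < D (N - k).+1) phi (rk l) l =
    \big[op/idx]_((N - k).+1 <= i < N.+1) \big[op/idx]_(D i.+1 <= l < D i) phi
      i l.
  by have := H N (leqnn N); rewrite subnn D1 big_mkord.
elim: k => [|k IHk] le_k; first by rewrite subn0 DN !big_geq.
have E : (N - k)%N = (N - k.+1).+1 by lia.
move: (IHk (ltnW le_k)); rewrite E => {}IHk.
rewrite [RHS]big_ltn; last by lia.
rewrite -IHk (big_cat_nat (n := D (N - k.+1).+2)) //= Monoid.mulmC;
  congr (op _ _).
rewrite big_nat_cond [RHS]big_nat_cond; apply: eq_bigr => l.
rewrite andbT => /andP[ge_l lt_l]; congr phi.
have lt_r : (l < r)%N := leq_trans lt_l (Dr _).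
apply/eqP; rewrite eqn_leq Dlt // lt_l andbT leqNgt Dlt //.
by rewrite -leqNgt.
Qed.

(** With [l = D + k], the power [p ^ (D + k)] cancels between numerator and denominator. *)
Lemma qbinom_prod (p N D m : nat) : (1 < p)%N -> (D + m <= N)%N ->
  \prod_(D <= l < D + m)
      ((p%:R ^+ N - p%:R ^+ l) / (p%:R ^+ (D + m) - p%:R ^+ l)) = qbinom p (N%:Z - D%:Z) m%:Z.
Proof.
move=> p_gt1 le_N; rewrite /qbinom ifT; last by lia.
have shift (G : nat -> rat) :
    \prod_(D <= l < D + m) G l = \prod_(k < m) G (D + k)%N.
  rewrite -{1}[D]add0n big_addn addKn big_mkord.
  by apply: eq_bigr => k _; rewrite addnC.
rewrite /= -prodf_div shift.
have p0 : (p%:R : rat) != 0 by rewrite pnatr_eq0; lia.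
apply: eq_bigr => k _; have lt_k := ltn_ord k.
have -> : N%:Z - D%:Z - k%:Z = (N - D - k)%N%:Z by lia.
have -> : m%:Z - k%:Z = (m - k)%N%:Z by lia.
have EN : N = (D + k + (N - D - k))%N by lia.
have Em : (D + m = D + k + (m - k))%N by lia.
rewrite -!exprnP {1}EN Em !(exprD _ (D + k)%N).
have fac (x : rat) : p%:R ^+ (D + k) * x - p%:R ^+ (D + k) =
    p%:R ^+ (D + k) * (x - 1) by rewrite mulrBr mulr1.
by rewrite !fac -mulf_div divff ?mul1r // expf_neq0.
Qed.

Lemma natr_expB (p a b : nat) : (0 < p)%N -> (b <= a)%N ->
  ((p ^ a - p ^ b)%N%:R : rat) = p%:R ^+ a - p%:R ^+ b.
Proof. by move=> p_gt0 le_ba; rewrite natrB ?natrX // leq_pexp2l. Qed.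

Lemma hom_count_ratio (p N r : nat) (rk D kA iA kM : nat -> nat) : (1 < p)%N ->
    (forall i l, (0 < i)%N -> (l < r)%N -> (i <= rk l)%N = (l < D i)%N) ->
    (forall i, (D i.+1 <= D i)%N) -> D 1%N = r -> D N.+1 = 0%N ->
    (forall i j, (0 < i <= j)%N -> (iA j <= iA i)%N) ->
  (\prod_(l < r) (p ^ kA (rk l) * (p ^ iA (rk l) - p ^ l)))%N%:R /
  (\prod_(l < r) (p ^ kM (rk l) * (p ^ D (rk l) - p ^ l)))%N%:R =
  (\prod_(1 <= i < N.+1)
     qbinom p ((iA i)%:Z - (D i.+1)%:Z) ((D i)%:Z - (D i.+1)%:Z)) *
  (\prod_(1 <= i < N.+1)
     (p%:R ^+ kA i / p%:R ^+ kM i) ^+ (D i - D i.+1)) :> rat.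
Proof.
move=> p_gt1 Dlt Ddec D1 DN iA_mono.
have p_gt0 : (0 < p)%N by lia.
have Dr i : (D i.+1 <= r)%N.
  by elim: i => [|i IHi]; rewrite ?D1 // (leq_trans (Ddec _)).
(* If some [iA i < D i], both sides vanish: the truncated difference at [l = (D i).-1] is zero, and
   so is the binomial at [i], whose lower entry exceeds its upper one. *)
have [/allP big|] := boolP (all (fun i => D i <= iA i)%N (index_iota 1 N.+1));
  last first.
  rewrite -has_predC => /hasP[i];
    rewrite mem_index_iota /= -ltnNge => i_rng lt_D.
  have lt_l : ((D i).-1 < r)%N.
    by case: i i_rng lt_D => // i _ lt_D; have := Dr i; lia.
  rewrite (bigD1 (Ordinal lt_l)) //=.
  have le_rk : (i <= rk (D i).-1)%N by rewrite Dlt //; lia.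
  have le_i : (iA (rk (D i).-1) <= (D i).-1)%N.
    by have := iA_mono i (rk (D i).-1); rewrite le_rk andbT; lia.
  have /eqP -> : (p ^ iA (rk (D i).-1) - p ^ (D i).-1 == 0)%N.
    by rewrite subn_eq0 leq_pexp2l.
  rewrite muln0 mul0n mul0r.
  rewrite (bigD1_seq i) ?mem_index_iota ?iota_uniq //=.
  rewrite {1}/qbinom ifF ?mul0r //; apply/negbTE; rewrite negb_and -!ltNge.
  by apply/orP; right; lia.
rewrite !natr_prod -prodf_div.
pose phi i l : rat := (p ^ kA i * (p ^ iA i - p ^ l))%N%:R / (p ^ kM i * (p ^ D
  i - p ^ l))%N%:R.
have := @prod_group_by_height _ _ (@GRing.mul rat : Monoid.com_law 1) N r rk D
  phi Dlt Ddec D1 DN.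
rewrite /phi => ->.
rewrite -big_split /= big_nat_cond [RHS]big_nat_cond.
apply: eq_bigr => i; rewrite andbT => i_rng.
have le_D : (D i <= iA i)%N by apply: big; rewrite mem_index_iota.
have DE : D i = (D i.+1 + (D i - D i.+1))%N by rewrite subnKC.
have -> : (D i)%:Z - (D i.+1)%:Z = (D i - D i.+1)%N%:Z by have := Ddec i; lia.
rewrite -qbinom_prod //; last by rewrite -DE.
rewrite -DE mulrC -prodr_const_nat -big_split /= big_nat_cond [RHS]big_nat_cond.
apply: eq_bigr => l; rewrite andbT => /andP[_ lt_l].
rewrite !natrM !natr_expB ?natrX //; try lia.
by rewrite mulf_div.
Qed.

(** * Kernels of surjections *)

(** Two proper subspaces never cover a space, even over the field with two elements: a basis column
    or a sum of two will do. *)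
Lemma common_nonzero_col (F : fieldType) n (x y : 'rV[F]_n) :
  x != 0 -> y != 0 -> exists z : 'cV[F]_n, x *m z != 0 /\ y *m z != 0.
Proof.
have colE (u : 'rV[F]_n) i : (u *m delta_mx i 0 == 0 :> 'cV_1) = (u 0 i == 0).
  by rewrite -colE; apply/eqP/eqP=> [/matrixP/(_ 0 0)|ui];
    [rewrite !mxE | apply/matrixP=> a b; rewrite !ord1 !mxE].
move=> /rV0Pn[i xi] /rV0Pn[j yj].
have [yi|yi] := eqVneq (y 0 i) 0; last by exists (delta_mx i 0); rewrite !colE.
have [xj|xj] := eqVneq (x 0 j) 0; last by exists (delta_mx j 0); rewrite !colE.
exists (delta_mx i 0 + delta_mx j 0); rewrite !mulmxDr.
move: xi yj yi xj; rewrite -!colE => xi yj /eqP; rewrite -colE => /eqP-> /eqP.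
by rewrite -colE => /eqP->; rewrite addr0 add0r.
Qed.

(* Elements of the socle are in the same orbit as soon as they have the same
   height: for z killed by S^(k+1) on the left and y by S^(k+1) on the right,
   1 + sum_a S^a z y S^(k-a) commutes with S, and it moves u by (u z) y S^k. *)
Lemma socle_orbit (F : fieldType) d (S : 'M[F]_d) N k (u v : 'rV[F]_d) :
    S ^+ N = 0 -> u *m S = 0 -> v *m S = 0 ->
    (u <= S ^+ k)%MS -> (v <= S ^+ k)%MS ->
    ~~ (u <= S ^+ k.+1)%MS -> ~~ (v <= S ^+ k.+1)%MS ->
  exists P : 'M[F]_d, [/\ S *m P = P *m S, row_full P & u *m P = v].
Proof.
move=> SN uS vS uk vk uNk vNk.
move: (uNk) (vNk); rewrite !submxE => uC vC.
(* A functional on the quotient by the image of [S ^+ k.+1] that is nonzero at both [u] and [v]; it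
   is then scaled to be 1 at [u]. *)
have [z0 [uz0 vz0]] := common_nonzero_col uC vC.
pose c := (u *m (cokermx (S ^+ k.+1) *m z0)) 0 0.
have cE : u *m (cokermx (S ^+ k.+1) *m z0) = c%:M.
  exact: mx11_scalar.
have c0 : c != 0.
  apply: contraNneq uz0 => c0; rewrite -mulmxA cE c0; apply/eqP/matrixP=> i j.
  by rewrite !mxE mul0rn.
pose z : 'cV[F]_d := c^-1 *: (cokermx (S ^+ k.+1) *m z0).
have Sz : S ^+ k.+1 *m z = 0 by rewrite -scalemxAr mulmxA mulmx_coker mul0mx
  scaler0.
have uz : u *m z = 1%:M.
  by rewrite -scalemxAr cE scale_scalar_mx mulVf.
have vz : v *m z != 0.
  by rewrite -scalemxAr mulmxA scaler_eq0 negb_or invr_eq0 c0.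
have /submxP[y yE] : (v - u <= S ^+ k)%MS by rewrite addmx_sub // eqmx_opp.
have yS : y *m S ^+ k.+1 = 0.
  by rewrite mx_exprSr mulmxA -yE mulmxBl uS vS subrr.
pose h := \sum_(a < k.+1) S ^+ a *m z *m y *m S ^+ (k - a).
have Sh : S *m h = h *m S.
  rewrite /h mulmx_sumr mulmx_suml big_ord_recr big_ord_recl /=.
  rewrite !mulmxA -mx_exprS Sz !mul0mx addr0.
  rewrite expr0 mul1mx subn0 -!mulmxA -mx_exprSr yS mulmx0 add0r.
  apply: eq_bigr => a _; rewrite !mulmxA -mx_exprS -!mulmxA;
    congr (_ *m (_ *m (_ *m _))).
  by rewrite -mx_exprSr /bump /= add1n subnSK.
(* On the socle only the term [a = 0] of [h] survives. *)
have soch (x : 'rV[F]_d) : x *m S = 0 -> x *m h = x *m z *m (v - u).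
  move=> xS; rewrite /h mulmx_sumr big_ord_recl big1 ?addr0 /=.
    by rewrite expr0 mul1mx subn0 yE !mulmxA.
  by move=> a _; rewrite /bump mx_exprS !mulmxA xS !mul0mx.
exists (1%:M + h); split.
- by rewrite mulmxDr mulmxDl Sh mulmx1 mul1mx.
- rewrite row_full_unit -row_free_unit -kermx_eq0; apply/rowV0P=> x.
  rewrite sub_kermx => /eqP xP.
  have SP : S *m (1%:M + h) = (1%:M + h) *m S.
    by rewrite mulmxDr mulmxDl Sh mulmx1 mul1mx.
  have xN : x *m S ^+ N = 0 by rewrite SN mulmx0.
  elim: N {SN} x xP xN => [|N IHN] x xP; first by rewrite expr0 mulmx1.
  rewrite mx_exprS mulmxA => xN.
  have {xN} xS : x *m S = 0.
    by apply: IHN xN; rewrite -mulmxA SP mulmxA xP mul0mx.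
  move: xP; rewrite mulmxDr mulmx1 soch // => xP.
  (* Multiplying the relation [xP] by [z] and using [u *m z = 1] leaves the product of [x *m z] and
     [v *m z], whose second factor is nonzero. *)
  suff xz : x *m z = 0 by move: xP; rewrite xz mul0mx addr0.
  move: (congr1 (mulmx^~ z) xP); rewrite mulmxDl mul0mx -mulmxA mulmxBl uz.
  rewrite mulmxBr mulmx1 addrC subrK.
  rewrite (mx11_scalar (v *m z)).
  rewrite mul_mx_scalar => /eqP; rewrite scaler_eq0 => /orP[|/eqP//].
  move=> /eqP vz00; case/negP: vz; apply/eqP/matrixP=> i j.
  by rewrite !ord1 vz00 mxE.
by rewrite mulmxDr mulmx1 soch // uz mul1mx addrC subrK.
Qed.

Lemma expr_sub (F : fieldType) e (S : 'M[F]_e) i j :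
  (i <= j)%N -> (S ^+ j <= S ^+ i)%MS.
Proof. by move=> le_ij; rewrite -(subnK le_ij) mx_exprD submxMl. Qed.

Section Fibres.

Variables (F : finFieldType) (d e : nat) (T : 'M[F]_d) (S : 'M[F]_e).

Definition aut_set := [set P : 'M[F]_e | (S *m P == P *m S) && row_full P].

Definition ker_set (X : 'M[F]_(d, e)) : {set 'rV[F]_d} := [set b | b *m X == 0].

Lemma ker_set_mul X P : P \in aut_set -> ker_set (X *m P) = ker_set X.
Proof.
rewrite inE => /andP[_ fuP]; apply/setP=> b; rewrite !inE mulmxA.
have frP : row_free P by rewrite row_free_unit -row_full_unit.
by rewrite -[in LHS](mul0mx _ P) (inj_eq (row_free_inj frP)).
Qed.

(** The fibres of [ker_set] are the orbits of the automorphism group, which acts freely on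
    surjections: two with the same kernel differ by a unique automorphism of the target. *)
Lemma card_ker_sets (good : {set 'M[F]_(d, e)}) :
    (forall X, X \in good -> T *m X = X *m S /\ row_full X) ->
    (forall X P, X \in good -> P \in aut_set -> X *m P \in good) ->
  #|good| = (#|ker_set @: good| * #|aut_set|)%N.
Proof.
move=> goodP goodM; rewrite -sum1_card (partition_big_imset ker_set) /=.
rewrite -sum_nat_const; apply: eq_bigr => _ /imsetP[X Xg ->].
have [TX fuX] := goodP X Xg; have /row_fullP[Z ZX] := fuX.
have XP_inj : injective (fun P : 'M[F]_e => X *m P).
  by move=> P P' eqP; rewrite -[P]mul1mx -[P']mul1mx -ZX -!mulmxA eqP.
rewrite sum1_card -(card_imset _ XP_inj); apply: eq_card => X'.
rewrite -topredE /=; apply/andP/imsetP=> [[X'g /eqP kerE]|[P Pa ->]];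
  last first.
  by rewrite goodM // ker_set_mul.
have [TX' fuX'] := goodP X' X'g.
(* The rows of [1 - X *m Z] lie in the kernel of [X], hence in that of [X']. *)
have X'E : X' = X *m (Z *m X').
  apply/eqP; rewrite -subr_eq0 -{1}[X']mul1mx mulmxA -mulmxBl;
    apply/eqP/row_matrixP=> i.
  rewrite row_mul row0; apply/eqP.
  have : row i (1%:M - X *m Z) \in ker_set X'.
    by rewrite kerE inE -row_mul mulmxBl mul1mx -mulmxA ZX mulmx1 subrr row0.
  by rewrite inE.
exists (Z *m X') => //; rewrite inE; apply/andP; split.
  apply/eqP; rewrite -[LHS]mul1mx -[RHS]mul1mx -ZX -!mulmxA; congr (Z *m _).
  rewrite (mulmxA X S) -TX -(mulmxA T X) -X'E TX'.
  by rewrite (mulmxA Z X') (mulmxA X) -X'E.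
rewrite /row_full eqn_leq rank_leq_row -{1}(eqP fuX') {1}X'E.
exact: mxrankM_maxr.
Qed.

Variables (N k : nat) (w : 'rV[F]_d) (v : 'rV[F]_e).
Hypotheses (SN : S ^+ N.+1 = 0) (lt_k : (k < N)%N) (wT : w *m T = 0) (vS : v *m
  S = 0).
Hypotheses (vk : (v <= S ^+ k)%MS) (vNk : ~~ (v <= S ^+ k.+1)%MS).

(* The term c *m S ^+ N is the norm of c, by norm_mx below. *)
Definition class_homs := [set X : 'M[F]_(d, e) |
  [&& T *m X == X *m S, row_full X &
      [exists c : 'rV[F]_e, w *m X == v + c *m S ^+ N]]].

Definition bounded_homs m := [set X : 'M[F]_(d, e) |
  [&& T *m X == X *m S, row_full X & (w *m X <= S ^+ m)%MS]].

Definition height_homs := bounded_homs k :\: bounded_homs k.+1.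

Lemma mem_height_homs X : (X \in height_homs) =
  [&& T *m X == X *m S, row_full X, (w *m X <= S ^+ k)%MS &
      ~~ (w *m X <= S ^+ k.+1)%MS].
Proof.
by rewrite !inE; case: (_ == _); case: (row_full X) => //=; rewrite andbC.
Qed.

(** The term [c *m S ^+ N] lies in the image of [S ^+ k.+1] and leaves the height [k] of [v]
    unchanged. Conversely [socle_orbit] carries [w *m X] onto [v] without changing the kernel, so
    that [c = 0] serves. *)
Lemma ker_sets_class_height : ker_set @: class_homs = ker_set @: height_homs.
Proof.
apply/setP=> h; apply/imsetP/imsetP=> -[X Xg ->].
  exists X => //; move: Xg; rewrite inE mem_height_homs.
  case/and3P=> -> -> /existsP[c /eqP->] /=.
  have cN : (c *m S ^+ N <= S ^+ k.+1)%MS.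
    by apply: submx_trans (submxMl _ _) (expr_sub S _).
  have cN' := submx_trans cN (expr_sub S (leqnSn k)).
  rewrite addmx_sub //=; apply: contra vNk => vc.
  by rewrite -[v](addrK (c *m S ^+ N)) addmx_sub // eqmx_opp.
move: Xg; rewrite mem_height_homs => /and4P[/eqP TX fuX wk wNk].
have wXS : w *m X *m S = 0 by rewrite -mulmxA -TX mulmxA wT mul0mx.
have [P [SP fuP wP]] := socle_orbit SN wXS vS wk vk wNk vNk.
have Pa : P \in aut_set by rewrite inE SP eqxx.
exists (X *m P); last by rewrite ker_set_mul.
rewrite inE; apply/and3P; split.
- by rewrite mulmxA TX -(mulmxA X S) SP mulmxA.
- rewrite /row_full mxrankMfree ?row_free_unit -?row_full_unit //.
apply/existsP; exists 0.
by rewrite mul0mx addr0 mulmxA wP.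
Qed.

Lemma card_height_homs :
  #|height_homs| = (#|bounded_homs k| - #|bounded_homs k.+1|)%N.
Proof.
rewrite cardsDS //; apply/subsetP=> X; rewrite !inE => /and3P[-> -> wX] /=.
exact: submx_trans wX (expr_sub S (leqnSn k)).
Qed.

Lemma leq_bounded_homs : (#|bounded_homs k.+1| <= #|bounded_homs k|)%N.
Proof.
apply/subset_leq_card/subsetP=> X; rewrite !inE => /and3P[-> -> wX] /=.
exact: submx_trans wX (expr_sub S (leqnSn k)).
Qed.

Lemma card_class_kernels :
  (#|ker_set @: class_homs| * #|aut_set| = #|bounded_homs k| - #|bounded_homs
    k.+1|)%N.
Proof.
rewrite ker_sets_class_height -card_height_homs; symmetry.
apply: card_ker_sets => [X|X P]; rewrite mem_height_homs.
  by case/and4P=> /eqP.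
case/and4P=> /eqP TX fuX wk wNk;
  rewrite mem_height_homs inE => /andP[/eqP SP fuP].
have uP : P \in unitmx by rewrite -row_full_unit.
have frP : row_free P by rewrite row_free_unit.
have powP i : S ^+ i *m P = P *m S ^+ i := hom_exp i SP.
apply/and4P; split.
- by rewrite mulmxA TX -(mulmxA X S) SP mulmxA.
- by rewrite /row_full mxrankMfree.
- by rewrite mulmxA (submx_trans (submxMr _ wk)) // powP submxMl.
apply: contra wNk; rewrite mulmxA => h.
rewrite -(mulmxK uP (w *m X)) (submx_trans (submxMr _ h)) //.
have /(congr1 (mulmx (invmx P))) := powP k.+1; rewrite mulKmx // mulmxA.
move=> /(congr1 (mulmx^~ (invmx P))); rewrite -mulmxA mulmxV // mulmx1 => E.
by rewrite -E submxMl.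
Qed.

End Fibres.

(** * Homomorphisms of cyclic extensions *)

(* In characteristic p the norm 1 + x + ... + x^(p^n - 1) is (x - 1)^(p^n - 1);
   the factor x - 1 is cancelled in the polynomial ring. *)
Lemma norm_mx (p n d : nat) (X : 'M['F_p]_d) : prime p ->
  \sum_(i < p ^ n) X ^+ i = (X - 1%:M) ^+ (p ^ n).-1.
Proof.
move=> p_pr.
have poly_norm : \sum_(i < p ^ n) 'X^i = ('X - 1) ^+ (p ^ n).-1 :> {poly 'F_p}.
  have X1_neq0 : 'X - 1 != 0 :> {poly 'F_p} by rewrite -[1]/(1%:P)
    polyXsubC_eq0.
  apply: (mulfI X1_neq0); rewrite -subrX1 -exprS prednK ?expn_gt0 ?prime_gt0 //.
  have ch : p \in [pchar {poly 'F_p}] by rewrite pchar_lalg pchar_Fp.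
  elim: n => [|n IHn]; first by rewrite !expr1.
  rewrite expnSr !exprM -IHn -!(pFrobenius_autE ch).
  by rewrite pFrobenius_autB_comm ?pFrobenius_aut1 //; apply: commr1.
case: d X => [|d] X; first by rewrite [LHS]flatmx0 [RHS]flatmx0.
have := congr1 (horner_mx X) poly_norm.
rewrite rmorph_sum rmorphXn rmorphB rmorph1 /= horner_mx_X => <-.
by apply: eq_bigr => i _; rewrite rmorphXn /= horner_mx_X.
Qed.

Section CycExtProj.

Variables (p : nat) (gT : finGroupType) (s : gT) (d : nat).
Variables (rG : mx_representation 'F_p <[s]>%g d) (w : fixvec rG).

Lemma ce_emb0 : ce_emb w 0 = 1%g.
Proof. by []. Qed.

Lemma ce_proj1 (x : cyc_ext w) : ce_proj x = 1%g -> x = ce_emb w (ce_pair x).1.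
Proof.
case: x => -[b i]; rewrite /ce_proj /= => /eqP; rewrite -order_dvdn => si.
congr (CycExt w (_, _)); apply: val_inj; rewrite /= mod0n.
by move: si; case: (posnP i) => // i_gt0; rewrite gtnNdvd.
Qed.

Lemma ce_proj_s (x : cyc_ext w) : ce_proj x = s ->
  exists c, x = (ce_emb w c * ce_hat w)%g.
Proof.
move=> xs; exists (ce_pair (x * (ce_hat w)^-1)%g).1.
rewrite -ce_proj1 ?mulgKV //; apply: (mulIg (ce_proj (ce_hat w))).
by rewrite -ce_projM mulgKV mul1g ce_proj_hat.
Qed.

(** Moving each [ce_hat w] to the right conjugates the copies of [c]; for [k = #[s]] their sum is
    the norm of [c]. *)
Lemma emb_hatX c k : ((ce_emb w c * ce_hat w) ^+ k)%g =
  (ce_emb w (c *m \sum_(i < k) rG s ^+ i) * ce_hat w ^+ k)%g.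
Proof.
elim: k => [|k IHk]; first by rewrite big_ord0 mulmx0 ce_emb0 mul1g.
rewrite expgS IHk big_ord_recl expr0 mulmxDr mulmx1 cyc_ext_embM.
have -> : c *m (\sum_(i < k) rG s ^+ bump 0 i) = c *m (\sum_(i < k) rG s ^+ i)
  *m rG s.
  rewrite -mulmxA mulmx_suml; congr (_ *m _); apply: eq_bigr => i _.
  exact: exprSr.
by rewrite -cyc_ext_conj expgS !mulgA mulgKV.
Qed.

Lemma emb_hat_conj c b :
  ((ce_emb w c * ce_hat w) * ce_emb w b * (ce_emb w c * ce_hat w)^-1)%g =
  ce_emb w (b *m rG s).
Proof.
apply: (mulIg (ce_emb w c * ce_hat w)%g); rewrite mulgKV -mulgA.
have -> : (ce_hat w * ce_emb w b = ce_emb w (b *m rG s) * ce_hat w)%g.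
  by rewrite -cyc_ext_conj mulgKV.
by rewrite !mulgA -!cyc_ext_embM addrC.
Qed.

End CycExtProj.

Section ExtHoms.

Variables (p n : nat) (gT : finGroupType) (s : gT).
Hypotheses (p_pr : prime p) (os : #[s]%g = (p ^ n)%N).
Variables (dA dM : nat).
Variables (rA : mx_representation 'F_p <[s]>%g dA) (wA : fixvec rA).
Variables (rM : mx_representation 'F_p <[s]>%g dM) (wM : fixvec rM).

Let norm := (rM s - 1%:M) ^+ (p ^ n).-1.

Lemma emb_hat_pow c : ((ce_emb wM c * ce_hat wM) ^+ #[s])%g =
  ce_emb wM (val wM + c *m norm).
Proof.
by rewrite emb_hatX cyc_ext_pow -cyc_ext_embM addrC os norm_mx.
Qed.

Lemma ext_hom_of_mx (X : 'M['F_p]_(dA, dM)) (c : 'rV_dM) :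
    rA s *m X = X *m rM s -> val wA *m X = val wM + c *m norm -> row_full X ->
  exists f : cyc_ext wA -> cyc_ext wM,
    [/\ {morph f : x y / x * y >-> x * y}%g,
        forall x, ce_proj (f x) = ce_proj x,
        forall x, f x = 1%g <-> x \in ce_emb wA @: ker_set X
      & forall y, exists x, f x = y].
Proof.
move=> sX wX fuX.
pose t := (ce_emb wM c * ce_hat wM)%g.
have [|b||f [fM femb fhat]] := @cyc_ext_univ p gT s dA rA wA _ (fun b => ce_emb
  wM (b *m X)) t.
- by move=> b c' /=; rewrite mulmxDl cyc_ext_embM.
- by rewrite emb_hat_conj -!mulmxA sX.
- by rewrite emb_hat_pow wX.
have f1 : f 1%g = 1%g by apply: (mulIg (f 1%g)); rewrite -fM !mul1g.
have fX x k : f (x ^+ k)%g = (f x ^+ k)%g.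
  by elim: k => // k IHk; rewrite !expgS fM IHk.
have fproj x : ce_proj (f x) = ce_proj x.
  rewrite (cyc_ext_gen x) fM femb fX fhat !ce_projM !ce_proj_emb;
    congr (_ * _)%g.
  elim: (nat_of_ord _) => [|k IHk]; first by rewrite !expg0 /ce_proj /= !mod0n.
  by rewrite !expgS !ce_projM IHk !ce_proj_emb ce_proj_hat mul1g ce_proj_hat.
exists f; split=> // [x|y].
  split=> [fx|/imsetP[b]]; last by rewrite inE => /eqP bX ->;
    rewrite femb bX ce_emb0.
  have xE : x = ce_emb wA (ce_pair x).1.
    by apply: ce_proj1; rewrite -fproj fx /ce_proj /= mod0n.
  apply/imsetP; exists (ce_pair x).1 => //; rewrite inE.
  by move: fx; rewrite xE femb -(ce_emb0 wM) => /cyc_ext_emb_inj/= ->.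
have /row_fullP[Z ZX] := fuX.
have embI b : exists x, f x = ce_emb wM b.
  by exists (ce_emb wA (b *m Z)); rewrite femb -mulmxA ZX mulmx1.
(* [f] sends [ce_hat wA] to [c] times [ce_hat wM]; a preimage of [- c] removes the excess. *)
have [x1 fx1] := embI (- c).
have fh : f (x1 * ce_hat wA)%g = ce_hat wM.
  by rewrite fM fx1 fhat mulgA -cyc_ext_embM addNr ce_emb0 mul1g.
have [x2 fx2] := embI (ce_pair y).1.
by exists (x2 * (x1 * ce_hat wA) ^+ (ce_pair y).2)%g;
  rewrite fM fX fh fx2 -cyc_ext_gen.
Qed.

(** Compatibility with the projections makes [f] restrict to the modules; conjugation by [ce_hat wA]
    gives equivariance, and its [#[s]]-th power gives the relation between [wA] and [wM]. *)
Lemma mx_of_ext_hom (f : cyc_ext wA -> cyc_ext wM) :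
    {morph f : x y / x * y >-> x * y}%g ->
    (forall x, ce_proj (f x) = ce_proj x) -> (forall y, exists x, f x = y) ->
  exists X : 'M['F_p]_(dA, dM), exists c : 'rV_dM,
    [/\ rA s *m X = X *m rM s, val wA *m X = val wM + c *m norm, row_full X &
        forall x, f x = 1%g <-> x \in ce_emb wA @: ker_set X].
Proof.
move=> fM fproj fsurj.
pose th b := (ce_pair (f (ce_emb wA b))).1.
have thE b : f (ce_emb wA b) = ce_emb wM (th b).
  by apply: ce_proj1; rewrite fproj ce_proj_emb.
have thD : {morph th : b c / b + c}.
  move=> b c; apply: (@cyc_ext_emb_inj _ _ _ _ _ wM).
  by rewrite cyc_ext_embM -!thE cyc_ext_embM fM.
have th0 : th 0 = 0 by apply: (addrI (th 0)); rewrite -thD !addr0.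
have thMn b k : th (b *+ k) = th b *+ k.
  by elim: k => [|k IHk]; rewrite ?mulr0n // !mulrS thD IHk.
(* Additive maps over a prime field are linear, as every scalar is a multiple of 1. *)
have thZ (a : 'F_p) b : th (a *: b) = a *: th b.
  by rewrite -[a]natr_Zp !scaler_nat.
pose X : 'M['F_p]_(dA, dM) := \matrix_i th (delta_mx 0 i).
have thX b : th b = b *m X.
  rewrite {1}[b]row_sum_delta (big_morph th thD th0) mulmx_sum_row.
  by apply: eq_bigr => i _; rewrite thZ rowK.
have f1 : f 1%g = 1%g by apply: (mulIg (f 1%g)); rewrite -fM !mul1g.
have fX x k : f (x ^+ k)%g = (f x ^+ k)%g.
  by elim: k => // k IHk; rewrite !expgS fM IHk.
have fV x : f x^-1%g = (f x)^-1%g.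
  by apply: (mulIg (f x)); rewrite -fM !mulVg.
have [c fhat] : exists c, f (ce_hat wA) = (ce_emb wM c * ce_hat wM)%g.
  by apply: ce_proj_s; rewrite fproj ce_proj_hat.
exists X, c; split.
- apply/row_matrixP=> i; rewrite !rowE !mulmxA -!thX.
  apply: (@cyc_ext_emb_inj _ _ _ _ _ wM).
  by rewrite -thE -cyc_ext_conj !fM fV fhat thE emb_hat_conj.
- apply: (@cyc_ext_emb_inj _ _ _ _ _ wM).
  by rewrite -thX -thE -cyc_ext_pow fX fhat emb_hat_pow.
- rewrite -sub1mx; apply/row_subP=> i.
  have [x fx] := fsurj (ce_emb wM (row i 1%:M)).
  have xE : x = ce_emb wA (ce_pair x).1.
    by apply: ce_proj1; rewrite -fproj fx ce_proj_emb.
  move: fx; rewrite xE thE => /cyc_ext_emb_inj <-.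
  by rewrite thX submxMl.
move=> x; split=> [fx|/imsetP[b]]; last first.
  by rewrite inE => /eqP bX ->; rewrite thE thX bX ce_emb0.
have xE : x = ce_emb wA (ce_pair x).1.
  by apply: ce_proj1; rewrite -fproj fx /ce_proj /= mod0n.
apply/imsetP; exists (ce_pair x).1 => //; rewrite inE -thX.
by move: fx; rewrite xE thE -(ce_emb0 wM) => /cyc_ext_emb_inj/= ->.
Qed.

End ExtHoms.

(** * Solutions inside E *)

Section Solutions.

Local Open Scope group_scope.

Variables (k : fieldType) (Om : splittingFieldType k) (F K E : {subfield Om}).
Hypotheses (galFE : galois F E) (sKE : (K <= E)%VS).
Variables (hG : finGroupType) (phi : hG -> gal_of K).

(** [f] and restriction to the fixed field have the same kernel, so [f] factors through an
    isomorphism; that kernel acts trivially on [K], which puts [K] inside the fixed field. *)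
Lemma fixedField_solves (f : {morphism 'Gal(E / F)%g >-> hG}) :
    phi 1%g = 1%g -> (f @* 'Gal(E / F) = [set: hG])%g ->
    (forall x a, x \in 'Gal(E / F)%g -> a \in K -> phi (f x) a = x a) ->
  solves F K (fixedField_aspace ('ker f)) phi.
Proof.
move=> phi1 fsurj fK; set L := fixedField_aspace _.
have galFL : galois F L by apply: (normal_fixedField_galois galFE);
  apply: ker_normal.
have [sFL _ nFL] := and3P galFL.
have sLE : (L <= E)%VS by apply: fixedField_bound.
have sFLE : (F <= L <= E)%VS by rewrite sFL.
have kerE : 'Gal(E / L)%g = 'ker f by apply: gal_fixedField.
have sKL : (K <= L)%VS.
  apply/subvP=> a Ka; apply/fixedFieldP=> [|x xker]; first exact: (subvP sKE).
  by rewrite -fK ?(dom_ker xker) // (mker xker) phi1 gal_id.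
pose q := normalField_cast_morphism sFLE nFL.
have kerq : 'ker q = 'ker f by rewrite (normalField_ker sFLE nFL).
have imq : (q @* 'Gal(E / F) = 'Gal(L / F))%g := normalField_img galFE sFLE nFL.
have skqf : 'ker q \subset 'ker f by rewrite kerq.
pose h := factm_morphism skqf (subxx _).
have hM : {in 'Gal(L / F)%g &, {morph h : x y / (x * y)%g}}.
  by rewrite -imq; apply: morphM.
have hq x : x \in 'Gal(E / F)%g -> h (q x) = f x by move=> Gx; apply: factmE.
have qP x : x \in 'Gal(L / F)%g -> exists2 y, y \in 'Gal(E / F)%g & x = q y.
  by rewrite -imq => /morphimP[y Gy _ ->]; exists y.
split=> //; exists (Morphism hM); split.
  apply/isomP; split.
    apply/injmP=> x y /qP[x' Gx' ->] /qP[y' Gy' ->] /=; rewrite !hq // => eq_f.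
    have kxy : (x' * y'^-1)%g \in 'ker q.
      by rewrite kerq; apply/kerP;
        rewrite ?groupM ?groupV // morphM ?groupV // morphV // eq_f mulgV.
    have := mker kxy; rewrite morphM ?groupV // morphV // => /eqP.
    by rewrite -eq_mulgV1 => /eqP.
  apply/setP=> y; rewrite inE; apply/morphimP.
  have: y \in (f @* 'Gal(E / F))%g by rewrite fsurj inE.
  case/morphimP=> x Gx _ ->; exists (q x) => /=; rewrite ?hq //.
    by rewrite -imq mem_morphim.
  by rewrite -imq mem_morphim.
move=> x a /qP[y Gy ->] Ka /=; rewrite hq // fK //.
by rewrite (normalField_cast_eq sFLE nFL) // (subvP sKL).
Qed.

Lemma solves_lift (L : {subfield Om}) : solves F K L phi -> (L <= E)%VS ->
  exists f : {morphism 'Gal(E / F)%g >-> hG},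
    [/\ (f @* 'Gal(E / F) = [set: hG])%g,
        forall x a, x \in 'Gal(E / F)%g -> a \in K -> phi (f x) a = x a
      & 'ker f = 'Gal(E / L)%g].
Proof.
case=> sKL galFL [psi [/isomP[injpsi impsi] psiK]] sLE.
have [sFL _ nFL] := and3P galFL.
have sFLE : (F <= L <= E)%VS by rewrite sFL.
pose q := normalField_cast_morphism sFLE nFL.
have imq : (q @* 'Gal(E / F) = 'Gal(L / F))%g := normalField_img galFE sFLE nFL.
have qL x : x \in 'Gal(E / F)%g -> q x \in 'Gal(L / F)%g.
  by move=> Gx; rewrite -imq mem_morphim.
have hM : {in 'Gal(E / F)%g &, {morph psi \o q : x y / (x * y)%g}}.
  by move=> x y Gx Gy; rewrite /= -(morphM psi) ?qL // -(morphM q).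
exists (Morphism hM); split.
- apply/setP=> y; rewrite inE; apply/morphimP.
  have: y \in (psi @* 'Gal(L / F))%g by rewrite impsi inE.
  case/morphimP=> x Lx _ ->.
  have /morphimP[z Gz _ ->] : x \in q @* 'Gal(E / F) by rewrite imq.
  by exists z.
- move=> x a Gx Ka /=; rewrite psiK ?qL //.
  by rewrite (normalField_cast_eq sFLE nFL) // (subvP sKL).
rewrite -(normalField_ker sFLE nFL) -/q; apply/setP=> x.
apply/idP/idP=> kx; have Gx := dom_ker kx; apply/kerP=> //.
  have := mker kx; rewrite /= -(morph1 psi) => /(injmP injpsi); apply=> //.
  exact: qL.
by rewrite /= (mker kx) morph1.
Qed.

End Solutions.

Section SolutionKernels.

Variables (p n : nat) (p_pr : prime p).
Variables (k : fieldType) (Om : splittingFieldType k) (F K E : {subfield Om}).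
Variables (s : gal_of K) (os : #[s]%g = (p ^ n)%N).
Variables (dA dM : nat).
Variables (rA : mx_representation 'F_p <[s]>%g dA) (wA : fixvec rA).
Variables (rM : mx_representation 'F_p <[s]>%g dM) (wM : fixvec rM).

Let T := rA s - 1%:M.
Let S := rM s - 1%:M.
Let good := class_homs T S (p ^ n).-1 (val wA) (val wM).

Lemma mem_good X : reflect
  [/\ rA s *m X = X *m rM s, row_full X &
      exists c, val wA *m X = val wM + c *m S ^+ (p ^ n).-1] (X \in good).
Proof.
have E1 : (T *m X == X *m S) = (rA s *m X == X *m rM s).
  by rewrite mulmxBl mulmxBr mul1mx mulmx1 (inj_eq (addIr _)).
rewrite inE E1; apply: (iffP and3P) => [[/eqP ? ? /existsP[c /eqP ?]]|[/eqP ? ?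
  [c ?]]].
  by split=> //; exists c.
by split=> //; apply/existsP; exists c; apply/eqP.
Qed.

(** Identify ['Gal(E / F)] with the extension by [A]. Solutions are the fixed fields of kernels of
    surjections compatible with the projections, and such a kernel lies in [A], as the kernel of a
    matrix in [good]. *)
Lemma solution_kernels : solves F K E (@ce_proj _ _ _ _ _ wA) ->
  exists Lof : {set 'rV['F_p]_dA} -> {subfield Om},
    {in @ker_set _ _ _ @: good &, injective Lof} /\
    (forall L : {subfield Om},
      (L <= E)%VS /\ solves F K L (@ce_proj _ _ _ _ _ wM) <->
      L \in [seq Lof h | h in @ker_set _ _ _ @: good]).
Proof.
case=> sKE galFE [psi [/isomP[injpsi impsi] psiK]].
pose D (h : {set 'rV['F_p]_dA}) := [set x in 'Gal(E / F)%g | psi x \in ce_emb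
  wA @: h].
pose Lof h := fixedField_aspace (D h).
have psi_surj y : exists2 x, x \in 'Gal(E / F)%g & psi x = y.
  have : y \in (psi @* 'Gal(E / F))%g by rewrite impsi inE.
  by case/morphimP=> x Gx _ ->; exists x.
have D_inj : injective D.
  move=> h1 h2 eqD; apply/setP=> b; have [x Gx psix] := psi_surj (ce_emb wA b).
  move/setP/(_ x): eqD; rewrite !inE Gx psix /=.
  by rewrite !mem_imset //; apply: cyc_ext_emb_inj.
have proj1 : @ce_proj _ _ _ _ _ wM 1%g = 1%g by rewrite /ce_proj /= mod0n.
have lift X : X \in good -> exists f : {morphism 'Gal(E / F)%g >-> cyc_ext wM},
    [/\ (f @* 'Gal(E / F) = setT)%g,
      forall x a, x \in 'Gal(E / F)%g -> a \in K -> ce_proj (f x) a = x a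
      & ('ker f)%g = D (ker_set X)].
  case/mem_good=> sX fuX [c wX].
  have [f [fM fproj fker fsurj]] := ext_hom_of_mx p_pr os sX wX fuX.
  have hM : {in 'Gal(E / F)%g &, {morph f \o psi : x y / (x * y)%g}}.
    by move=> x y Gx Gy; rewrite /= -fM -(morphM psi).
  exists (Morphism hM); split.
  - apply/setP=> y; rewrite [RHS]inE; apply/morphimP.
    have [x <-] := fsurj y; have [z Gz <-] := psi_surj x.
    by exists z.
  - by move=> x a Gx Ka; rewrite /= fproj psiK.
  apply/setP=> x; rewrite [RHS]inE; apply/idP/andP=> [kx|[Gx kx]].
    by have := mker kx; have := dom_ker kx => Gx /= /fker.
  by apply/kerP=> //=; apply/fker.
exists Lof; split.
  move=> _ _ /imsetP[X1 X1g ->] /imsetP[X2 X2g ->] eqL; apply: D_inj.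
  have [f1 [_ _ ker1]] := lift _ X1g; have [f2 [_ _ ker2]] := lift _ X2g.
  have := congr1 (fun L : {subfield Om} => 'Gal(E / L)%g) eqL.
  by rewrite /= -ker1 -ker2 !gal_fixedField.
move=> L; split=> [[sLE solL]|/imageP[_ /imsetP[X Xg ->] ->]]; last first.
  have [f [fsurj fK kerf]] := lift _ Xg; split; first exact: fixedField_bound.
  by rewrite /Lof -kerf; apply: fixedField_solves.
have [f [fsurj fK kerf]] := solves_lift galFE solL sLE.
have psiT x : x \in (psi @* 'Gal(E / F))%g by rewrite impsi inE.
(* The inverse of [psi], as a plain function on the whole extension, so that [mx_of_ext_hom] applies
   to [f \o ip]. *)
have [ip [ipM ipG ipK ipE]] : exists ip : cyc_ext wA -> gal_of E,
    [/\ {morph ip : x y / x * y >-> x * y}%g, forall x, ip x \in 'Gal(E / F)%g,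
        cancel ip psi & {in 'Gal(E / F)%g, cancel psi ip}].
  exists (invm injpsi); split=> [x y|x|x|x Gx].
  - exact: morphM.
  - by have [y Gy <-] := psi_surj x; rewrite invmE.
  - exact: invmK.
  exact: invmE.
have [|x|y|X [c [sX wX fuX kerX]]] := @mx_of_ext_hom p n _ s p_pr os _ _ rA wA
  rM wM (f \o ip).
- by move=> x y; rewrite /= -(morphM f) // -ipM.
- by apply/eqP/gal_eqP=> a Ka; rewrite /= fK // -psiK // ipK.
- have : y \in (f @* 'Gal(E / F))%g by rewrite fsurj inE.
  by case/morphimP=> x Gx _ ->; exists (psi x); rewrite /= ipE.
apply/imageP; exists (ker_set X).
  by apply: imset_f; apply/mem_good; split=> //; exists c.
apply: val_inj => /=.
have galLE : galois L E.
  have [sKL galFL _] := solL; have [sFL _ _] := and3P galFL.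
  by apply: (galoisS _ galFE); rewrite sFL.
rewrite -[LHS](galois_fixedField galLE) -kerf; congr fixedField.
apply/setP=> x; rewrite [RHS]inE.
apply/idP/andP=> [kx|[Gx kx]].
  have Gx := dom_ker kx; split=> //; apply/kerX.
  by rewrite /= ipE // (mker kx).
by apply/kerP=> //; move/kerX: kx; rewrite /= ipE.
Qed.

End SolutionKernels.

(** * The count *)

Lemma mxrank_cap_eqmx (F : fieldType) d (A B C : 'M[F]_d) :
  (B :=: C)%MS -> \rank (A :&: B)%MS = \rank (A :&: C)%MS.
Proof. by move=> eqBC; rewrite (cap_eqmx (eqmx_refl A) eqBC). Qed.

(** * Layer dimensions and heights of summand socles *)

Section DeltaRank.

Variables (p : nat) (gT : finGroupType) (s : gT) (d n : nat).
Variable rG : mx_representation 'F_p <[s]>%g d.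
Hypotheses (p_pr : prime p) (os : #[s]%g = (p ^ n)%N).

Let S := rG s - 1%:M.

(** The fixed space is [kermx S], so this is rank-nullity for [S] on the image of [S ^+ i]. *)
Lemma Delta_rank i : (\rank (S ^+ i.+1) + Delta rG i.+1 = \rank (S ^+ i))%N.
Proof.
have fixE : (rfix_mx rG <[s]>%g :=: kermx S)%MS.
  apply/eqmxP/andP; split.
    rewrite sub_kermx mulmxBr mulmx1 subr_eq0; apply/eqP.
    by apply: (rfix_mxP _ (submx_refl _)); apply: cycle_id.
  apply/rfix_mxP=> _ /cycleP[j ->].
  have fixS : kermx S *m rG s = kermx S.
    by apply/eqP; rewrite -subr_eq0 -{2}[kermx S]mulmx1 -mulmxBr mulmx_ker.
  elim: j => [|j IHj]; first by rewrite expg0 repr_mx1 mulmx1.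
  by rewrite expgS repr_mxM ?mem_cycle ?cycle_id // mulmxA fixS.
have := mxrank_mul_ker (S ^+ i) S; rewrite -(mxrank_cap_eqmx (S ^+ i) fixE).
by rewrite -mx_exprSr.
Qed.

Lemma Delta_dec i : (Delta rG i.+1 <= Delta rG i)%N.
Proof.
apply: mxrankS; apply: capmxS => //; apply: expr_sub.
by rewrite /= leq_pred.
Qed.

Lemma Delta_eq0 : Delta rG (p ^ n).+1 = 0%N.
Proof.
have := Delta_rank (p ^ n); rewrite (bullet_nilp rG p_pr os) mxrank0.
by move/eqP; rewrite addn_eq0 => /andP[_ /eqP].
Qed.

Lemma summand_socle (D : cyclic_decomp rG) i0 :
  D i0 *m S ^+ (\rank (cyclic_mx rG (D i0))).-1 *m S = 0.
Proof.
case E: (\rank _) => [|nu];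
  last by rewrite -mulmxA -mx_exprSr -E (cyclic_ann _ _ p_pr os).
by move/eqP: E; rewrite mxrank_eq0 cyclic_mx_eq0 => /eqP->; rewrite !mul0mx.
Qed.

(** If the socle vector were [y *m S ^+ nu], the component of [y] in its summand would be killed,
    placing the vector in the complement. It would then be zero, and [nu.-1] vectors would span the
    summand. *)
Lemma summand_height (D : cyclic_decomp rG) i0 nu :
  \rank (cyclic_mx rG (D i0)) = nu -> (0 < nu)%N ->
  ~~ (D i0 *m S ^+ nu.-1 <= S ^+ nu)%MS.
Proof.
move=> rk nu_gt0; set v := D i0 *m _.
have powW W i : mxmodule rG W -> (W *m S ^+ i <= W)%MS.
  move=> Wmod; elim: i => [|i IHi]; first by rewrite expr0 mulmx1.
  rewrite mx_exprSr mulmxA (submx_trans (submxMr _ IHi)) //.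
  rewrite mulmxBr mulmx1 addmx_sub ?eqmx_opp //.
  by have /mxmoduleP-> := Wmod; rewrite ?cycle_id.
apply/negP=> /submxP[y vE].
have: (y <= \sum_(i < cd_size D) cyclic_mx rG (D i))%MS by rewrite (cd_full D)
  submx1.
rewrite (bigD1 i0) //= => /sub_addsmxP[[a b] /= yE].
set C0 := cyclic_mx rG (D i0) in yE *;
  set C' := (\sum_(i < _ | _) _)%MS in yE *.
have C0S : C0 *m S ^+ nu = 0.
  apply/eqP; rewrite -submx0.
  apply: submx_trans (submxMr _ (cyclic_mx_sub_powers rG p_pr os _)) _.
  rewrite sumsmxMr_gen; apply/sumsmx_subP=> j _.
  rewrite genmxE (eqmxMr _ (genmxE _)) -mulmxA -mx_exprD addnC mx_exprD mulmxA.
  by rewrite -rk (cyclic_ann _ _ p_pr os) mul0mx sub0mx.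
have vC' : (v <= C')%MS.
  rewrite vE yE mulmxDl -!mulmxA C0S mulmx0 add0r.
  apply: submx_trans (submxMl _ _) _; apply: powW.
  apply: sumsmx_module => i _; exact: cyclic_mx_module.
have vC0 : (v <= C0)%MS.
  by apply: submx_trans (submxMr _ (cyclic_mx_id rG _)) _; apply: powW;
    apply: cyclic_mx_module.
have v0 : v = 0.
  apply/eqP; rewrite -submx0.
  by have /mxdirect_sumsP/(_ i0 isT) <- := cd_direct D; rewrite sub_capmx vC0.
have : (C0 <= \sum_(a < nu.-1) <<D i0 *m S ^+ a>>)%MS.
  apply: submx_trans (cyclic_mx_sub_powers rG p_pr os _) _; rewrite rk.
  apply/sumsmx_subP=> -[j lt_j] _ /=; rewrite genmxE.
  case: (ltnP j nu.-1) => [lt_j'|ge_j];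
    first by rewrite (sumsmx_sup (Ordinal lt_j')) ?genmxE.
  have -> : j = nu.-1 by lia.
  by rewrite -/v v0 sub0mx.
move/mxrankS; rewrite rk leqNgt => /negP; apply.
have := mxrank_sum_rows_le (fun a : 'I_nu.-1 => D i0 *m S ^+ a) setT.
rewrite cardsT card_ord; under eq_bigl do rewrite inE.
by move=> le_nu; rewrite (leq_ltn_trans le_nu) // prednK.
Qed.

End DeltaRank.

Lemma antitone_count (P : pred nat) r l :
  (forall i j, (i <= j < r)%N -> P j -> P i) -> (l < r)%N ->
  P l = (l < \sum_(j < r) P j)%N.
Proof.
elim: r => // r IHr Panti; rewrite ltnS big_ord_recr /= => le_l.
have sum_le : (\sum_(j < r) P j <= r)%N.
  by rewrite -[leqRHS]card_ord -sum1_card; apply: leq_sum => j _; case: (P j).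
have [Pr|NPr] := boolP (P r).
  have -> : (\sum_(j < r) P j = r)%N.
    rewrite -[RHS]card_ord -sum1_card; apply: eq_bigr => j _.
    by rewrite (Panti j r) // ltnSn andbT ltnW.
  by rewrite addn1 ltnS le_l (Panti l r) // le_l ltnSn.
rewrite addn0; have [lt_l|ge_l] := ltnP l r.
  apply: IHr => // i j /andP[le_ij lt_j]; apply: Panti.
  by rewrite le_ij ltnW.
have -> : l = r by apply/eqP; rewrite eqn_leq le_l.
by rewrite (negbTE NPr) ltnNge sum_le.
Qed.

(** * Kernel dimensions from the height of [w] *)

Section KerDim.

Variables (F : fieldType) (d : nat) (T : 'M[F]_d) (w : 'rV[F]_d).

Lemma ker_dim_mono m i j : w *m T = 0 -> (0 < i <= j)%N ->
  (ker_dim T w (j <= m) j - ker_dim T w (j <= m) j.-1 <=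
   ker_dim T w (i <= m) i - ker_dim T w (i <= m) i.-1)%N.
Proof.
case: i j => [|i] [|j] //= wT; rewrite ltnS => le_ij.
have kE b l : (ker_dim T w b l.+1 - ker_dim T w b l)%N = \rank (kerU T^T w^T b
  l.+1 *m T^T ^+ l).
  by rewrite -!mxrank_kerU_tr -mxrank_kerU_mul addnK.
rewrite !kE; apply/mxrankS/kerU_mul_mono => //.
- by rewrite -trmx_mul wT trmx0.
- by move=> h; apply: leq_trans h.
by move/eqP->.
Qed.

Variable lam : nat.
Hypotheses (lam_gt0 : (0 < lam)%N) (w_le : (w <= T ^+ lam.-1)%MS).
Hypothesis w_nle : ~~ (w <= T ^+ lam)%MS.

Lemma height_sub i : (w <= T ^+ i)%MS = (i < lam)%N.
Proof.
apply/idP/idP=> [wi|lt_i]; last by apply: submx_trans w_le (expr_sub _ _); lia.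
by rewrite ltnNge; apply: contra w_nle => le_i;
  apply: submx_trans wi (expr_sub _ _).
Qed.

Lemma ker_dimE (b : bool) i :
  (ker_dim T w b i)%:Z = d%:Z - (\rank (T ^+ i))%:Z - ((lam <= i)%N && b)%:Z.
Proof.
have := rank_leq_row (T ^+ i); rewrite /ker_dim height_sub -leqNgt.
have [le_i|] := leqP lam i; rewrite ?andbF /=; last by lia.
(* This strict bound keeps the natural subtraction from truncating; at full rank [w] would lie in
   the image, against [lam <= i]. *)
suff lt_d : (\rank (T ^+ i) < d)%N by case: b => /=; lia.
rewrite ltn_neqAle rank_leq_row andbT; apply: contraL le_i => fu.
by rewrite -ltnNge -height_sub submx_full.
Qed.

End KerDim.

Lemma ker_dim_le (F : fieldType) d (T : 'M[F]_d) (w : 'rV[F]_d) b i :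
  (ker_dim T w b i <= ker_dim T w b i.+1)%N.
Proof. by rewrite -!mxrank_kerU_tr -mxrank_kerU_mul leq_addl. Qed.

Section SumDelta.

Variables (p : nat) (gT : finGroupType) (s : gT) (d : nat).
Variable rG : mx_representation 'F_p <[s]>%g d.

Lemma sum_Delta lam (b : bool) i : (0 < lam)%N ->
  \sum_(1 <= j < i.+1) ((Delta rG j)%:Z - (j == lam)%:Z * b%:Z) =
  d%:Z - (\rank ((rG s - 1%:M) ^+ i))%:Z - ((lam <= i)%N && b)%:Z.
Proof.
move=> lam_gt0; elim: i => [|i IHi].
  rewrite big_geq // expr0 mxrank1 leqNgt lam_gt0 /=; lia.
rewrite big_nat_recr //= {}IHi -(Delta_rank rG i).
rewrite [(lam <= i.+1)%N]leq_eqVlt ltnS [i.+1 == lam]eq_sym.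
move: (\rank _) (Delta _ _) => a c.
case: eqP => [E|_] /=; first by rewrite E ltnn; case: b => /=; lia.
by case: (_ && b) => /=; lia.
Qed.

Lemma sum_Delta0 i : \sum_(1 <= j < i.+1) (Delta rG j)%:Z =
  d%:Z - (\rank ((rG s - 1%:M) ^+ i))%:Z.
Proof.
have := @sum_Delta 1 false i isT; rewrite andbF subr0 => <-.
by apply: eq_bigr => j _; rewrite mulr0 subr0.
Qed.

End SumDelta.

(** * The ratio of bounded surjections to automorphisms *)

Section BoundedRatio.

Variables (p n : nat) (gT : finGroupType) (s : gT).
Hypotheses (p_pr : prime p) (os : #[s]%g = (p ^ n)%N).
Variables (dA dM : nat).
Variables (rA : mx_representation 'F_p <[s]>%g dA).
Variables (rM : mx_representation 'F_p <[s]>%g dM) (decM : cyclic_decomp rM).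

Let T := rA s - 1%:M.
Let S := rM s - 1%:M.

Variables (w : 'rV['F_p]_dA) (lam : nat).
Hypotheses (wT : w *m T = 0) (lam_gt0 : (0 < lam)%N).
Hypotheses (w_le : (w <= T ^+ lam.-1)%MS) (w_nle : ~~ (w <= T ^+ lam)%MS).

Lemma card_aut_set_gt0 : (0 < #|aut_set S|)%N.
Proof.
apply/card_gt0P; exists 1%:M; rewrite inE mulmx1 mul1mx eqxx /=.
by rewrite /row_full mxrank1.
Qed.

Lemma bounded_ratio m : (lam <= m)%N ->
  #|bounded_homs T S w m|%:R / #|aut_set S|%:R =
  (\prod_(1 <= i < (p ^ n).+1)
     qbinom p ((Delta rA i)%:Z - (Delta rM i.+1)%:Z - (i == lam)%:Z)
              ((Delta rM i)%:Z - (Delta rM i.+1)%:Z)) *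
  (\prod_(1 <= i < (p ^ n).+1)
     (p%:R ^ (\sum_(1 <= j < i)
                 ((Delta rA j)%:Z - (j == lam)%:Z * (i <= m)%N%:Z))
      / p%:R ^ (\sum_(1 <= j < i) (Delta rM j)%:Z))
     ^ ((Delta rM i)%:Z - (Delta rM i.+1)%:Z)) :> rat.
Proof.
move=> le_m; have p_gt1 := prime_gt1 p_pr.
have [r [rk [g [jg rk_gt0 rk_mono]]]] := jordan_of_decomp p_pr os decM.
have rkS i : \rank (S ^+ i) = (\sum_(l < r) (rk l - i))%N := (jordan_ranks jg
  i).1.
(* [Delta] counts the Jordan blocks of size above [i], as is seen by comparing consecutive ranks. *)
have DE i : Delta rM i.+1 = (\sum_(l < r) (i < rk l))%N.
  apply/eqP; rewrite -(eqn_add2l (\rank (S ^+ i.+1))) Delta_rank !rkS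
    -big_split /=.
  apply/eqP/eq_bigr => l _; case: ltnP; lia.
have Dlt i l : (0 < i)%N -> (l < r)%N -> (i <= rk l)%N = (l < Delta rM i)%N.
  case: i => // i _ lt_l; rewrite DE.
  apply: (antitone_count (P := fun l => i < rk l)%N) => // a b ab.
  by move/leq_trans; apply; apply: rk_mono.
have D1 : Delta rM 1 = r.
  rewrite DE -[RHS]card_ord -sum1_card; apply: eq_bigr => l _.
  by rewrite rk_gt0.
have cardF : #|'F_p| = p by rewrite card_Fp.
pose kA i := ker_dim T w (i <= m)%N i.-1.
pose iA i := (ker_dim T w (i <= m)%N i - ker_dim T w (i <= m)%N i.-1)%N.
pose kM i := (dM - \rank (S ^+ i.-1))%N.
have -> : #|bounded_homs T S w m| =
    (\prod_(l < r) (p ^ kA (rk l) * (p ^ iA (rk l) - p ^ l)))%N.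
  rewrite /bounded_homs (card_surjective_homs m jg rk_gt0 rk_mono wT).
  by rewrite cardF.
have kd0 b i : ker_dim S 0 b i = (dM - \rank (S ^+ i))%N.
  by rewrite /ker_dim sub0mx andbF subn0.
have -> : #|aut_set S| =
    (\prod_(l < r) (p ^ kM (rk l) * (p ^ Delta rM (rk l) - p ^ l)))%N.
  (* Automorphisms are the surjections of [M] onto itself; taking [w = 0] makes the bound hold
     trivially. *)
  have := card_surjective_homs 0 jg rk_gt0 rk_mono (mul0mx 1 S); rewrite cardF.
  rewrite (eq_card (B := aut_set S)); last first.
    by move=> P; rewrite !inE mul0mx sub0mx andbT.
  move=> ->; apply: eq_bigr => l _; rewrite !kd0; congr (_ * (_ ^ _ - _))%N.
  have := rk_gt0 l (ltn_ord l); case: (rk l) => //= i _.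
  have := Delta_rank rM i; rewrite -/S; have := rank_leq_row (S ^+ i); lia.
rewrite (@hom_count_ratio p (p ^ n) r rk (Delta rM) kA iA kM p_gt1 Dlt
  (Delta_dec rM) D1 (Delta_eq0 rM p_pr os)); last first.
  by move=> i j; apply: ker_dim_mono.
congr (_ * _); rewrite big_nat_cond [RHS]big_nat_cond;
  apply: eq_bigr => -[|i] //= _.
  congr qbinom; rewrite /iA /=.
  have := ker_dim_le T w (i < m)%N i.
  have := ker_dimE lam_gt0 w_le w_nle (i < m)%N i.
  have := ker_dimE lam_gt0 w_le w_nle (i < m)%N i.+1.
  rewrite -/T; have := Delta_rank rA i; rewrite -/T.
  move: (ker_dim _ _ _ _) (ker_dim _ _ _ _) (\rank _) (\rank _) (Delta rA _)
    (Delta rM _) => a b t1 t2 D D'.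
  rewrite [(lam <= i.+1)%N]leq_eqVlt ltnS [i.+1 == lam]eq_sym.
  (* At [i.+1 = lam] the available rank drops by one exactly when the flag [i < m] is set, and
     [lam <= m] sets it. *)
  case: eqP => [E|_] /=; first by rewrite -E le_m leqNgt E ltnSn /=; lia.
  by case: (_ && _) => /=; lia.
have -> : (Delta rM i.+1)%:Z - (Delta rM i.+2)%:Z = (Delta rM i.+1 - Delta rM
  i.+2)%N%:Z.
  by have := Delta_dec rM i.+1; lia.
rewrite -exprnP; congr (_ ^+ _).
rewrite sum_Delta // sum_Delta0 -/T -/S /kA /kM /=.
rewrite -(ker_dimE lam_gt0 w_le w_nle (i < m)%N i).
have -> : dM%:Z - (\rank (S ^+ i))%:Z = (dM - \rank (S ^+ i))%N%:Z.
  by have := rank_leq_row (S ^+ i); lia.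
by rewrite -!exprnP.
Qed.

End BoundedRatio.

Theorem theorem5p10
  (p n : nat) (p_pr : prime p)
  (k : fieldType) (Om : splittingFieldType k) (F K E : {subfield Om})
  (galKF : galois F K)
  (sigma : gal_of K)
  (gen_sigma : 'Gal(K / F)%g = <[sigma]>%g)
  (o_sigma : #[sigma]%g = (p ^ n)%N)
  (dA : nat) (rA : mx_representation 'F_p <[sigma]>%g dA)
  (decA : cyclic_decomp rA)
  (lam : nat) (lam_gt0 : (0 < lam)%N) (lam_le : (lam <= p ^ n)%N)
  (defA : bullet_defined decA lam)
  (solE : solves F K E (bullet_proj p_pr o_sigma defA))
  (dM : nat) (rM : mx_representation 'F_p <[sigma]>%g dM)
  (decM : cyclic_decomp rM)
  (mu : nat) (j0 : 'I_(cd_size decM))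
  (dim_j0 : \rank (cyclic_mx rM (decM j0)) = mu)
  (lt_lam_mu : (lam < mu)%N) (lt_mu : (mu < #[sigma]%g)%N) :
  exists Ls : seq {subfield Om},
    [/\ uniq Ls,
        forall L : {subfield Om},
          L \in Ls <->
          (L <= E)%VS /\
          solves F K L
            (bullet_proj p_pr o_sigma (BulletSummand dim_j0 lt_mu)) &
        (size Ls)%:R =
          (\prod_(1 <= i < (p ^ n).+1)
              qbinom p
                ((Delta rA i)%:Z - (Delta rM i.+1)%:Z - (i == lam)%:Z)
                ((Delta rM i)%:Z - (Delta rM i.+1)%:Z))
          * ((\prod_(1 <= i < (p ^ n).+1)
                (p%:R ^ (\sum_(1 <= j < i)
                            ((Delta rA j)%:Z - (j == lam)%:Z * (i < mu)%N%:Z))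
                 / p%:R ^ (\sum_(1 <= j < i) (Delta rM j)%:Z))
                ^ ((Delta rM i)%:Z - (Delta rM i.+1)%:Z))
             - (\prod_(1 <= i < (p ^ n).+1)
                (p%:R ^ (\sum_(1 <= j < i)
                            ((Delta rA j)%:Z - (j == lam)%:Z * (i <= mu)%N%:Z))
                 / p%:R ^ (\sum_(1 <= j < i) (Delta rM j)%:Z))
                ^ ((Delta rM i)%:Z - (Delta rM i.+1)%:Z)))
          :> rat].
Proof.
have mu_gt0 : (0 < mu)%N by apply: leq_ltn_trans lt_lam_mu.
have [Lof [Lof_inj LofP]] := solution_kernels p_pr o_sigma
  (bullet_class p_pr o_sigma (BulletSummand dim_j0 lt_mu)) solE.
set wA := val (bullet_class p_pr o_sigma defA) in Lof_inj LofP *.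
set kers := imset _ _ in Lof_inj LofP.
exists [seq Lof h | h in kers]; split.
- by rewrite map_inj_in_uniq ?enum_uniq // => x y; rewrite !mem_enum;
  apply: Lof_inj.
- by move=> L; split=> /LofP.
rewrite size_map -cardE.
have [wT w_le w_nle] : [/\ wA *m (rA sigma - 1%:M) = 0,
    (wA <= (rA sigma - 1%:M) ^+ lam.-1)%MS & ~~ (wA <= (rA sigma - 1%:M) ^+
      lam)%MS].
  (* The semidirect case is excluded, since [lam < mu < #[sigma]]. *)
  rewrite /wA /=; case: (defA) => [i0 rk_i0 lt_i0|lamE]; last first.
    by have := ltn_trans lt_lam_mu lt_mu; rewrite -lamE ltnn.
  rewrite /bullet_vec submxMl; split=> //.
    by move: (summand_socle p_pr o_sigma i0); rewrite rk_i0.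
  exact: (summand_height p_pr o_sigma).
set T := rA sigma - 1%:M in wT w_le w_nle *.
set S := rM sigma - 1%:M.
pose v := decM j0 *m S ^+ mu.-1.
have cardK : (#|kers| * #|aut_set S| =
    #|bounded_homs T S wA mu.-1| - #|bounded_homs T S wA mu|)%N.
  have := @card_class_kernels _ _ _ T S (p ^ n).-1 mu.-1 wA v.
  rewrite prednK ?expn_gt0 ?prime_gt0 // prednK //; apply => //.
  - exact: (bullet_nilp rM p_pr o_sigma).
  - by have := lt_mu; rewrite o_sigma; lia.
  - by move: (summand_socle p_pr o_sigma j0); rewrite dim_j0.
  - by rewrite submxMl.
  exact: (summand_height p_pr o_sigma).
have aut0 : (#|aut_set S|%:R : rat) != 0.
  by rewrite pnatr_eq0 -lt0n card_aut_set_gt0.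
have le_B : (#|bounded_homs T S wA mu| <= #|bounded_homs T S wA mu.-1|)%N.
  by have := leq_bounded_homs T S mu.-1 wA; rewrite prednK.
have -> : (#|kers|%:R : rat) = #|bounded_homs T S wA mu.-1|%:R / #|aut_set S|%:R
    - #|bounded_homs T S wA mu|%:R / #|aut_set S|%:R.
  by rewrite -mulrBl -natrB // -cardK natrM mulfK.
(* The two terms are [bounded_ratio] at [m = mu] and at [m = mu.-1]; the latter needs [lam <= mu.-1]
   and turns [i <= m] into [i < mu]. *)
rewrite mulrBr -!(bounded_ratio p_pr o_sigma decM wT) //; last exact: ltnW.
congr (_ - _); rewrite (bounded_ratio p_pr o_sigma decM wT lam_gt0 w_le w_nle);
  last first.
  by rewrite -ltnS prednK.
congr (_ * _); apply: eq_bigr => i _; congr ((_ ^ _ / _) ^ _).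
by apply: eq_bigr => j _; congr (_ - _ * (_ : bool)%:Z); rewrite -ltnS prednK.
Qed.
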